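(* Let $K,L\subset\mathbb{R}^n$ be convex bodies. Then $$\mathcal{W}(K\cap L)\,\mathcal{W}\left(\frac{K-L}{2}\right)\leq 2^n\,\mathcal{W}(K)\,\mathcal{W}(L),$$ where $\mathcal{W}$ is the Wills functional. In particular, $$\mathcal{W}(K-K)\leq 2^n\,\mathcal{W}(2K).$$
   Context: A convex body in $\mathbb{R}^n$ is a non-empty compact convex set; $K-L=K+(-L)=\{x-y:x\in K,\,y\in L\}$; $\mathrm{vol}$ is $n$-dimensional Lebesgue measure. With $B_2^n$ the Euclidean unit ball and $\kappa_j=\mathrm{vol}_j(B_2^j)=\pi^{j/2}/\Gamma(j/2+1)$, the intrinsic volumes $\mathrm{V}_i(K)$, $0\le i\le n$, of a convex body $K$ are defined by the Steiner formula $\mathrm{vol}(K+\lambda B_2^n)=\sum_{i=0}^n\kappa_{n-i}\mathrm{V}_i(K)\lambda^{n-i}$ for all $\lambda\geq 0$. The Wills functional is $\mathcal{W}(K)=\sum_{i=0}^n\mathrm{V}_i(K)$; equivalently, $\mathcal{W}(K)=\int_{\mathbb{R}^n}e^{-\pi d(x,K)^2}\,dx$, where $d(x,K)$ is the Euclidean distance from $x$ to $K$. Convention: $\mathcal{W}(\emptyset)=0$. *)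

(* Defs.v *)
From mathcomp Require Import all_boot all_order all_algebra.
From mathcomp Require Import all_classical all_reals all_analysis.
Import Order.TTheory GRing.Theory Num.Theory.
Import numFieldNormedType.Exports.

Set Implicit Arguments.
Unset Strict Implicit.
Unset Printing Implicit Defensive.

Local Open Scope classical_set_scope.
Local Open Scope ring_scope.

(* The norm that the library puts on 'rV[R]_n is the sup norm, so the Euclidean
   one is spelled out. Both induce the topology used in [compact] below. *)
Definition enorm (R : realType) (n : nat) (x : 'rV[R]_n) : R :=
  Num.sqrt (\sum_(i < n) x 0 i ^+ 2).

Definition eball (R : realType) (n : nat) : set 'rV[R]_n :=
  [set x | enorm x <= 1].

Definition minkowski_add (R : realType) (n : nat) (A B : set 'rV[R]_n) :
  set 'rV[R]_n :=
  [set x + y | x in A & y in B].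

Definition dilate (R : realType) (n : nat) (c : R) (A : set 'rV[R]_n) :
  set 'rV[R]_n := [set c *: x | x in A].

(* The Minkowski sum of A and -B; neither the set difference nor the erosion of
   A by B. *)
Definition minkowski_sub (R : realType) (n : nat) (A B : set 'rV[R]_n) :
  set 'rV[R]_n :=
  [set x - y | x in A & y in B].

Definition convex_body (R : realType) (n : nat) (K : set 'rV[R]_n) : Prop :=
  [/\ K !=set0, compact K & convex_set K].

(* n-dimensional Lebesgue measure, as the n-fold product of the one-dimensional
   one: the successor case is the value of the library's product measure
   [lebesgue_measure \x vol n] (namely the integral of the measures of the
   sections), transported along R * 'rV_n ~ 'rV_n.+1. In dimension 0 it is the
   unit mass on the only point. *)
Fixpoint vol (R : realType) (n : nat) : set 'rV[R]_n -> \bar R :=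
  match n return set 'rV[R]_n -> \bar R with
  | 0 => fun A => (\1_A (0 : 'rV[R]_0))%:E
  | m.+1 => fun A =>
      (\int[@lebesgue_measure R]_t
         vol [set y : 'rV[R]_m | A (row_mx t%:M y : 'rV[R]_(1 + m))])%E
  end.

Definition kappa (R : realType) (j : nat) : R := fine (vol (@eball R j)).

Definition steiner (R : realType) (n : nat) (K : set 'rV[R]_n)
    (V : 'I_n.+1 -> R) : Prop :=
  forall lambda : R, 0 <= lambda ->
    vol (minkowski_add K (dilate lambda (@eball R n))) =
    (\sum_(i < n.+1) kappa R (n - i) * V i * lambda ^+ (n - i))%:E.

(* The Steiner formula determines its coefficients, since kappa_j > 0. The value
   0 is a placeholder for sets K for which it has no solution. *)
Definition intrinsic_volume (R : realType) (n : nat) (K : set 'rV[R]_n) :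
  'I_n.+1 -> R := xget (fun=> 0) [set V | steiner K V].

(* The convention W(set0) = 0 needs no separate case: set0 + lambda B is empty,
   so V = 0 is the solution of the Steiner formula for K = set0. *)
Definition wills (R : realType) (n : nat) (K : set 'rV[R]_n) : R :=
  \sum_(i < n.+1) intrinsic_volume K i.

(* Main.v *)
(** The intrinsic volumes are packaged as W(K) = int exp(-pi d(x,K)^2) dx, and
    W(K) W(L) = int int exp(-pi (d(w+y,K)^2 + d(y,L)^2)) dy dw.  Let p = (k-l)/2
    be the point of M = (K-L)/2 nearest to w and substitute
    y = a/2 + (k+l)/4 - w/2.  Comparing w+y and y with the midpoints of [q,k] and
    [q,l], where q is the point of K n L nearest to a, the parallelogram identity
    bounds the exponent by d(a, K n L)^2 + d(w,M)^2; the Jacobian of the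
    substitution is 2^-n.

    The integral formula follows from Steiner's by a layer cake argument, the
    moments of the radial density being found by taking K = {0}.  Steiner's
    formula itself is obtained for zonotopes in place of the ball: vol(K + t[0,v])
    is affine in t, because the part swept between times a and a+b is a translate
    of the part swept between 0 and b, so vol(K + tZ) is a polynomial in t for
    every sum Z of segments, of degree at most n by its growth.  Zonotopes
    approximate the ball (average reflected copies of one of them), and the
    polynomials of degree at most n are closed under pointwise limits. *)
From HB Require Import structures.
Require Import Defs.
From mathcomp Require Import all_boot all_order all_algebra.
From mathcomp Require Import all_classical all_reals all_analysis.
From mathcomp Require Import measurable_realfun ring lra.
Import Order.TTheory GRing.Theory Num.Theory.
Import numFieldNormedType.Exports.
Set Implicit Arguments.
Unset Strict Implicit.
Unset Printing Implicit Defensive.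
Local Open Scope classical_set_scope.
Local Open Scope ring_scope.

(** * Lebesgue measure on row vectors *)

(** [wills] is built from coefficients that [xget] picks among the solutions of Steiner's formula,
    and [vol] is a recursion on arbitrary sets. So existence and uniqueness of the coefficients, and
    the fact that [vol] is a sigma-finite measure, have to come before any estimate. A zonotope
    close to the ball may need many segments, and each of them raises the a priori degree of the
    volume polynomial by one. The growth of order r^n brings the degree back to n, uniformly in the
    approximation; n+1 values then determine the polynomial, which is why it survives the limit. The
    substitution in the product inequality is forced. Whatever y is, the errors of w+y and y against
    the midpoints (q+k)/2 and (q+l)/2 differ by w-p; the choice of y makes their sum equal to a-q.
    The squared errors then add up to half of |a-q|^2 + |w-p|^2, so the bound on the exponent has
    room to spare. *)

Definition rV_display : measure_display. Proof. exact. Qed.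

Section rV_measurable.
Variables (R : realType) (n : nat).

(** The coordinates generate the sigma-algebra chosen here, which makes measurability of a map into
    row vectors a coordinatewise matter. That it contains the open sets is [open_measurable_rV]. *)
Definition rV_coord (i : 'I_n) (x : 'rV[R]_n) : measurableTypeR R := x 0 i.

Let rV_measurable0 : g_sigma_preimage rV_coord set0.
Proof. exact: sigma_algebra0. Qed.

Let rV_measurableC A : g_sigma_preimage rV_coord A ->
  g_sigma_preimage rV_coord (~` A).
Proof. exact: sigma_algebraC. Qed.

Let rV_measurable_bigcup (F : _^nat) :
  (forall i, g_sigma_preimage rV_coord (F i)) ->
  g_sigma_preimage rV_coord (\bigcup_i (F i)).
Proof. exact: sigma_algebra_bigcup. Qed.

HB.instance Definition _ := @isMeasurable.Build rV_display
  'rV[R]_n (g_sigma_preimage rV_coord)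
  rV_measurable0 rV_measurableC rV_measurable_bigcup.

End rV_measurable.

Lemma measurable_rV_coord (R : realType) n (i : 'I_n) :
  measurable_fun setT (fun x : 'rV[R]_n => x 0 i : R).
Proof.
move=> _ Y mY; rewrite setTI; apply: sub_sigma_algebra => /=.
rewrite -bigcup_seq/=; exists i => /=; first by rewrite mem_index_enum.
by exists Y => //; rewrite setTI.
Qed.

Lemma measurable_fun_rVP d (T : measurableType d) (R : realType) n
    (f : T -> 'rV[R]_n) :
  (forall i, measurable_fun setT (fun x => f x 0 i : R)) -> measurable_fun setT f.
Proof.
move=> mf _ A mA; rewrite setTI.
have : g_sigma_preimage (fun i => (@rV_coord R n i) \o f) (f @^-1` A).
  by rewrite g_sigma_preimage_comp; exists A => //; rewrite setTI.
apply: smallest_sub; first exact: sigma_algebra_measurable.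
move=> B; rewrite -bigcup_seq => -[i _ [C mC <-]].
exact: mf.
Qed.

Local Notation leb := lebesgue_measure.

Definition rV_cons (R : realType) m (p : measurableTypeR R * 'rV[R]_m) :
  'rV[R]_m.+1 := row_mx (p.1 : R)%:M p.2 : 'rV[R]_(1 + m).

Lemma rV_cons0 (R : realType) m (p : measurableTypeR R * 'rV[R]_m) :
  rV_cons p 0 ord0 = p.1.
Proof.
rewrite /rV_cons (_ : ord0 = lshift m (0 : 'I_1)); last exact/val_inj.
by rewrite (row_mxEl (p.1%:M : 'rV_1)) mxE eqxx mulr1n.
Qed.

Lemma rV_consS (R : realType) m (p : measurableTypeR R * 'rV[R]_m) (i : 'I_m) :
  rV_cons p 0 (lift ord0 i) = p.2 0 i.
Proof.
rewrite /rV_cons (_ : lift ord0 i = rshift 1 i); last exact/val_inj.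
by rewrite (row_mxEr (p.1%:M : 'rV_1)).
Qed.

Lemma measurable_rV_cons (R : realType) m : measurable_fun setT (@rV_cons R m).
Proof.
apply: measurable_fun_rVP => i; have [j ->|->] := unliftP ord0 i; last first.
  by under eq_fun do rewrite rV_cons0; exact: measurable_fst.
under eq_fun do rewrite rV_consS.
apply: (@measurableT_comp _ _ _ _ _ _ (fun x : 'rV[R]_m => x 0 j)) => //.
exact: measurable_rV_coord.
Qed.

Local Open Scope ereal_scope.

(** An equality of set functions on all sets, measurable or not: the product measure is itself
    defined by integrating the measures of sections. *)
Lemma vol_succE (R : realType) m :
  @vol R m.+1 = pushforward (leb \x @vol R m) (@rV_cons R m).
Proof.
apply/funext => A /=; rewrite /pushforward /product_measure1.
apply: eq_integral => t _ /=; congr (vol _).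
by apply/seteqP; split => y /=; rewrite /xsection/= inE.
Qed.

Definition rV_uncons (R : realType) m (x : 'rV[R]_m.+1) :
    measurableTypeR R * 'rV[R]_m :=
  (x 0 ord0, \row_i x 0 (lift ord0 i))%R.

Lemma rV_consK (R : realType) m : cancel (@rV_cons R m) (@rV_uncons R m).
Proof.
move=> p; rewrite /rV_uncons rV_cons0 [RHS]surjective_pairing; congr pair.
by apply/rowP => i; rewrite mxE rV_consS.
Qed.

Lemma measurable_rV_uncons (R : realType) m :
  measurable_fun setT (@rV_uncons R m).
Proof.
apply/measurable_fun_pairP; split; first exact: measurable_rV_coord.
apply: measurable_fun_rVP => i /=; under eq_fun do rewrite mxE.
exact: measurable_rV_coord.
Qed.

Section cons_measure.
Variables (R : realType) (n : nat).
Variable m : {sigma_finite_measure set 'rV[R]_n -> \bar R}.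

Definition cons_measure := pushforward (leb \x m) (@rV_cons R n).

HB.instance Definition _ := Measure.copy cons_measure
  (measure_function_pushforward__canonical__measure_function_Measure (leb \x m)
    (@measurable_rV_cons R n)).

Let cons_measure_sigma_finite : sigma_finite setT cons_measure.
Proof.
  have /sigma_finiteP[F [FT ndF Ff]] := sigma_finiteT (@lebesgue_measure R).
  have /sigma_finiteP[G [GT ndG Gf]] := sigma_finiteT m.
  (* Products of the two exhaustions cover because both are nondecreasing: a pair lies in the
     product at the larger of its two indices. *)
  exists (fun k => (@rV_uncons R n) @^-1` (F k `*` G k)).
    rewrite -preimage_bigcup -[LHS](preimage_setT (@rV_uncons R n)); congr (_ @^-1` _).
    apply/esym; rewrite -subTset -setXTT FT GT => -[x y] /= [[i _ Fi] [k _ Gk]].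
    exists (maxn i k) => //; split => /=.
      by move: x Fi; exact/subsetPset/ndF/leq_maxl.
    by move: y Gk; exact/subsetPset/ndG/leq_maxr.
  move=> k; have [mF Fy] := Ff k; have [mG Gy] := Gf k; split.
    rewrite -[X in measurable X]setTI; apply: measurable_rV_uncons => //.
    exact: measurableX.
  rewrite /cons_measure /pushforward -comp_preimage/=.
  rewrite (_ : _ \o _ = id); last by rewrite funeqE => x /=; rewrite rV_consK.
  rewrite preimage_id product_measure1E// lte_mul_pinfty// ge0_fin_numE//.
Qed.

HB.instance Definition _ := Measure_isSigmaFinite.Build _ _ _ cons_measure
  cons_measure_sigma_finite.

End cons_measure.

(** The induction has to carry a sigma-finite measure, since the next product requires one. The
    measure structure is afterwards transported to [vol] itself along this equality. *)
Lemma vol_measure_exists (R : realType) n :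
  {m : {sigma_finite_measure set 'rV[R]_n -> \bar R} | @vol R n = m}.
Proof.
elim: n => [|n [m volm]].
  exists (\d_(0%R : 'rV[R]_0)); apply/funext => A /=.
  by rewrite /dirac/=.
by exists (cons_measure m); rewrite vol_succE volm.
Qed.

Section vol_measure.
Variables (R : realType) (n : nat).
Let m := projT1 (vol_measure_exists R n).
Let volm : @vol R n = m := projT2 (vol_measure_exists R n).

Let vol0 : @vol R n set0 = 0. Proof. by rewrite volm measure0. Qed.
Let vol_ge0 A : 0 <= @vol R n A. Proof. by rewrite volm. Qed.
Let vol_sigma_additive : semi_sigma_additive (@vol R n).
Proof. by rewrite volm; exact: measure_semi_sigma_additive. Qed.

HB.instance Definition _ := isMeasure.Build _ _ _ (@vol R n)
  vol0 vol_ge0 vol_sigma_additive.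

Let vol_sigma_finite : sigma_finite setT (@vol R n).
Proof. by rewrite volm; exact: sigma_finiteT. Qed.

HB.instance Definition _ := Measure_isSigmaFinite.Build _ _ _ (@vol R n)
  vol_sigma_finite.
End vol_measure.

Lemma ge0_integral_volS (R : realType) m (f : 'rV[R]_m.+1 -> \bar R) :
  measurable_fun setT f -> (forall x, 0 <= f x) ->
  \int[@vol R m.+1]_x f x = \int[leb]_t \int[@vol R m]_y f (rV_cons (t, y)).
Proof.
move=> mf f0; rewrite vol_succE.
have mc := @measurable_rV_cons R m.
rewrite (ge0_integral_pushforward mc) //= preimage_setT fubini_tonelli1 //.
exact: measurableT_comp.
Qed.

(** * Change of variables under homotheties and translations *)

Lemma lebesgue_measure_affine (R : realType) (a b : R)
    (A : set (measurableTypeR R)) :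
  (0 < a)%R -> measurable A ->
  leb A = a%:E * leb ((fun t : measurableTypeR R => a * t + b)%R @^-1` A).
Proof.
move=> a0 mA.
pose f (t : measurableTypeR R) : measurableTypeR R := (a * t + b)%R.
have mf : measurable_fun setT f.
  have : measurable_fun setT (fun t : R => (a * t + b)%R).
    by apply: measurable_funD => //; exact: measurable_funM.
  by [].
pose nu : {measure set (measurableTypeR R) -> \bar R} :=
  measure_function_pushforward__canonical__measure_function_Measure leb mf.
pose mu : {measure set (measurableTypeR R) -> \bar R} :=
  mscale (NngNum (ltW a0)) nu.
(* Lebesgue measure is determined by its values on half-open intervals, so the rescaled image
   measure only has to be compared with it there. *)
apply: (@lebesgue_measure_unique R mu) => //= X [[x y] _ <-] /=.
rewrite /mscale/= /pushforward.
have -> : f @^-1` `]x, y]%classic = `]((x - b) / a)%R, ((y - b) / a)%R]%classic.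
  apply/seteqP; split => t /=; rewrite !in_itv/= /f.
    by rewrite ltr_pdivrMr// ler_pdivlMr// ltrBlDr lerBrDr mulrC.
  by rewrite ltr_pdivrMr// ler_pdivlMr// ltrBlDr lerBrDr mulrC.
rewrite !lebesgue_measure_itv/= !lte_fin ltr_pM2r ?invr_gt0//.
rewrite ltrD2r; case: ifPn => xy; last by rewrite mule0.
rewrite -!EFinB -EFinM; congr EFin; field.
by rewrite gt_eqF.
Qed.

Lemma ge0_integral_affine (R : realType) (a b : R)
    (f : measurableTypeR R -> \bar R) :
  (0 < a)%R -> measurable_fun setT f -> (forall x, 0 <= f x) ->
  \int[leb]_t f t = a%:E * \int[leb]_t f (a * t + b)%R.
Proof.
move=> a0 mf f0.
pose g (t : measurableTypeR R) : measurableTypeR R := (a * t + b)%R.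
have mg : measurable_fun setT g.
  have : measurable_fun setT (fun t : R => (a * t + b)%R).
    by apply: measurable_funD => //; exact: measurable_funM.
  by [].
pose nu : {measure set (measurableTypeR R) -> \bar R} :=
  measure_function_pushforward__canonical__measure_function_Measure leb mg.
pose mu : {measure set (measurableTypeR R) -> \bar R} :=
  mscale (NngNum (ltW a0)) nu.
rewrite (@eq_measure_integral _ _ _ setT mu); last first.
  by move=> A mA _; apply: lebesgue_measure_affine.
rewrite [LHS](ge0_integral_mscale nu)//; congr (_ * _).
by rewrite (ge0_integral_pushforward mg).
Qed.

Lemma measurable_rV_affine (R : realType) n (a : R) (b : 'rV[R]_n) :
  measurable_fun setT (fun x : 'rV[R]_n => (a *: x + b)%R).
Proof.
apply: measurable_fun_rVP => i; under eq_fun do rewrite !mxE.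
apply: (measurable_funD _ (measurable_cst _)).
by apply: measurable_funM => //; exact: measurable_rV_coord.
Qed.

(** Tonelli peels off one coordinate at a time, and each contributes a factor [a]. *)
Lemma ge0_integral_vol_affine (R : realType) n (a : R) (b : 'rV[R]_n)
    (f : 'rV[R]_n -> \bar R) :
  (0 < a)%R -> measurable_fun setT f -> (forall x, 0 <= f x) ->
  \int[@vol R n]_x f x = (a ^+ n)%:E * \int[@vol R n]_x f (a *: x + b)%R.
Proof.
move=> a0; elim: n => [|n IH] in b f *.
  move=> mf f0; rewrite expr0 mul1e; apply: eq_integral => x _.
  by congr f; apply/rowP; case.
move=> mf f0.
have mfab : measurable_fun setT (fun x : 'rV[R]_n.+1 => f (a *: x + b)%R).
  exact: (measurableT_comp mf (measurable_rV_affine _ _)).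
rewrite !ge0_integral_volS//.
have mc t : measurable_fun setT (fun y : 'rV[R]_n => f (rV_cons (t, y))).
  apply: (measurableT_comp mf).
  by apply: (measurableT_comp (@measurable_rV_cons R n)) => //; exact: measurable_pair1.
have Fm : measurable_fun setT (fun t : measurableTypeR R => \int[@vol R n]_y f (rV_cons (t, y))).
  apply: (@measurable_fun_fubini_tonelli_F _ _ _ _ _ (@vol R n) (f \o @rV_cons R n) _ (fun=> f0 _)).
  exact: (measurableT_comp mf (@measurable_rV_cons R n)).
have F0 (t : measurableTypeR R) : 0 <= \int[@vol R n]_y f (rV_cons (t, y)).
  exact: integral_ge0.
rewrite (ge0_integral_affine (b 0%R ord0) a0 Fm F0).
rewrite exprS EFinM -muleA; congr (_ * _).
have H t : \int[@vol R n]_y f (rV_cons ((a * t + b 0 ord0)%R, y)) =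
    (a ^+ n)%:E * \int[@vol R n]_y f (a *: rV_cons (t, y) + b)%R.
  rewrite (IH (\row_i b 0 (lift ord0 i))%R)//; congr (_ * _).
  apply: eq_integral => y _; congr f; apply/rowP => i.
  have -> : ((a *: rV_cons (t, y) + b) 0 i = a * rV_cons (t, y) 0 i + b 0 i)%R.
    by rewrite !mxE.
  have [j ->|->] := unliftP ord0 i; last by rewrite !rV_cons0.
  by rewrite !rV_consS/= !mxE.
under eq_integral do rewrite H.
rewrite ge0_integralZl//.
- apply: (@measurable_fun_fubini_tonelli_F _ _ _ _ _ (@vol R n)
    (fun p => f (a *: @rV_cons R n p + b)%R) _ (fun=> f0 _)).
  exact: (measurableT_comp mfab (@measurable_rV_cons R n)).
- by move=> t _; exact: integral_ge0.
- by rewrite lee_fin exprn_ge0// ltW.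
Qed.

Lemma vol_affine (R : realType) n (a : R) (b : 'rV[R]_n) (A : set 'rV[R]_n) :
  (0 < a)%R -> measurable A ->
  @vol R n A = (a ^+ n)%:E * @vol R n ((fun x => a *: x + b)%R @^-1` A).
Proof.
move=> a0 mA.
have mi : measurable_fun setT (EFin \o (\1_A : 'rV[R]_n -> R)).
  exact/measurable_EFinP/measurable_indic.
have h x : 0 <= (EFin \o (\1_A : 'rV[R]_n -> R)) x by rewrite /= lee_fin.
have := @ge0_integral_vol_affine R n a b _ a0 mi h.
rewrite integral_indic// setIT => ->; congr (_ * _).
set B := _ @^-1` _.
have mB : measurable B by rewrite -[B]setTI; exact: measurable_rV_affine.
by rewrite -[in RHS](setIT B) -integral_indic//.
Qed.

Lemma vol_box (R : realType) n (a b : R) : (a <= b)%R ->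
  @vol R n [set x | forall i, (a <= x 0 i <= b)%R] = ((b - a) ^+ n)%:E.
Proof.
move=> ab; elim: n => [|n IH].
  by rewrite /= indicE mem_set// => -[].
transitivity (\int[leb]_(t in setT)
    @vol R n [set y | forall i, (a <= rV_cons (t, y) 0 i <= b)%R]) => //.
rewrite (eq_integral (fun t : measurableTypeR R =>
    ((b - a) ^+ n)%:E * (\1_(`[a, b]%classic) t)%:E)).
  rewrite ge0_integralZl//=.
  - rewrite integral_indic//= setIT lebesgue_measure_itv/= lte_fin.
    case: ltgtP ab => // [ab _|-> _]; first by rewrite -EFinB -EFinM -exprSr.
    by rewrite subrr exprS mul0r mule0.
  - exact/measurable_EFinP/measurable_indic.
  - by rewrite lee_fin exprn_ge0// subr_ge0.
move=> t _; rewrite indicE.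
have [tab|tab] := boolP (t \in _).
  rewrite mule1 -IH; congr (vol _); apply/seteqP; split => y /= H i.
    by have := H (lift ord0 i); rewrite (rV_consS (t, y)).
  have [j ->|->] := unliftP ord0 i; first by rewrite (rV_consS (t, y)).
  by rewrite (rV_cons0 (t, y)); move: tab; rewrite inE.
rewrite mule0 -(@measure0 _ _ _ (@vol R n)); congr (vol _).
apply/seteqP; split => // y /= /(_ ord0); rewrite (rV_cons0 (t, y)) => H.
by move/negP: tab; apply; rewrite inE.
Qed.
Local Close Scope ereal_scope.
(** * Euclidean geometry of convex bodies *)

Section euclidean.
Variables (R : realType) (n : nat).
Implicit Types (x y z : 'rV[R]_n) (a b r : R).

Definition dotp x y : R := \sum_(i < n) x 0 i * y 0 i.

Lemma dotpC x y : dotp x y = dotp y x.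
Proof. by apply: eq_bigr => i _; rewrite mulrC. Qed.

Lemma dotpDl x y z : dotp (x + y) z = dotp x z + dotp y z.
Proof. by rewrite -big_split; apply: eq_bigr => i _; rewrite mxE mulrDl. Qed.

Lemma dotpDr x y z : dotp x (y + z) = dotp x y + dotp x z.
Proof. by rewrite dotpC dotpDl !(dotpC x). Qed.

Lemma dotpZl a x y : dotp (a *: x) y = a * dotp x y.
Proof. by rewrite mulr_sumr; apply: eq_bigr => i _; rewrite mxE mulrA. Qed.

Lemma dotpZr a x y : dotp x (a *: y) = a * dotp x y.
Proof. by rewrite dotpC dotpZl dotpC. Qed.

Lemma dotpNl x y : dotp (- x) y = - dotp x y.
Proof. by rewrite -scaleN1r dotpZl mulN1r. Qed.

Lemma dotpNr x y : dotp x (- y) = - dotp x y.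
Proof. by rewrite dotpC dotpNl dotpC. Qed.

Definition dotpE := (dotpDl, dotpDr, dotpZl, dotpZr, dotpNl, dotpNr).

Lemma dotp0l y : dotp 0 y = 0.
Proof. by rewrite -(scale0r 0) dotpZl mul0r. Qed.

Lemma dotpp_ge0 x : 0 <= dotp x x.
Proof. by apply: sumr_ge0 => i _; rewrite -expr2 sqr_ge0. Qed.

Lemma enorm_sqr x : enorm x ^+ 2 = dotp x x.
Proof.
rewrite sqr_sqrtr; last by apply: sumr_ge0 => i _; rewrite sqr_ge0.
by apply: eq_bigr => i _; rewrite expr2.
Qed.

Lemma enorm_ge0 x : 0 <= enorm x. Proof. exact: sqrtr_ge0. Qed.

Lemma enorm_le x y : (enorm x <= enorm y) = (dotp x x <= dotp y y).
Proof. by rewrite -!enorm_sqr ler_pXn2r ?nnegrE ?enorm_ge0. Qed.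

Lemma enormZ a x : enorm (a *: x) = `|a| * enorm x.
Proof.
apply/eqP; rewrite -(@eqrXn2 _ 2) ?mulr_ge0 ?enorm_ge0// exprMn !enorm_sqr.
by rewrite !dotpE real_normK ?num_real// mulrA.
Qed.

Lemma enormN x : enorm (- x) = enorm x.
Proof. by rewrite -scaleN1r enormZ normrN1 mul1r. Qed.

Lemma enormB x y : enorm (x - y) = enorm (y - x).
Proof. by rewrite -enormN opprB. Qed.

Lemma enorm0 : enorm (0 : 'rV[R]_n) = 0.
Proof. by rewrite -(scale0r 0) enormZ normr0 mul0r. Qed.

Lemma coord_enorm x i : `|x 0 i| <= enorm x.
Proof.
rewrite -(@ler_pXn2r _ 2) ?nnegrE ?enorm_ge0// enorm_sqr real_normK ?num_real//.
rewrite expr2 /dotp (bigD1 i)//= lerDl.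
by apply: sumr_ge0 => j _; rewrite -expr2 sqr_ge0.
Qed.

Lemma enorm_eq0 x : enorm x = 0 -> x = 0.
Proof.
move=> x0; apply/rowP => i; apply/eqP; rewrite mxE -normr_le0.
by rewrite (le_trans (coord_enorm x i))// x0.
Qed.

Lemma dotp_le_enorm x y : dotp x y <= enorm x * enorm y.
Proof.
have [->|x0] := eqVneq x 0; first by rewrite dotp0l enorm0 mul0r.
have [->|y0] := eqVneq y 0; first by rewrite dotpC dotp0l enorm0 mulr0.
have a0 : 0 < enorm x.
  by rewrite lt_def enorm_ge0 andbT; apply: contra x0 => /eqP/enorm_eq0 ->.
have b0 : 0 < enorm y.
  by rewrite lt_def enorm_ge0 andbT; apply: contra y0 => /eqP/enorm_eq0 ->.
(* This square expands to 2 |x| |y| (|x| |y| - x.y), whose leading factor is positive. *)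
have := dotpp_ge0 (enorm y *: x - enorm x *: y).
rewrite !dotpE -!enorm_sqr (dotpC y x).
set a := enorm x in a0 *; set b := enorm y in b0 *; set d := dotp x y => H.
rewrite -(ler_pM2l (mulr_gt0 a0 b0)); nra.
Qed.

Lemma enormD x y : enorm (x + y) <= enorm x + enorm y.
Proof.
rewrite -(@ler_pXn2r _ 2) ?nnegrE ?addr_ge0 ?enorm_ge0// enorm_sqr.
rewrite !dotpE -!enorm_sqr (dotpC y x).
have := dotp_le_enorm x y; lra.
Qed.

Lemma enorm_le_sum x : enorm x <= \sum_(i < n) `|x 0 i|.
Proof.
have s0 : 0 <= \sum_(i < n) `|x 0 i| by apply: sumr_ge0 => i _; rewrite normr_ge0.
rewrite -(@ler_pXn2r _ 2) ?nnegrE ?enorm_ge0// enorm_sqr.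
rewrite expr2 mulr_sumr; apply: ler_sum => i _.
rewrite -expr2 -real_normK ?num_real// expr2; apply: ler_wpM2r => //.
rewrite (bigD1 i)//= lerDl.
by apply: sumr_ge0 => j _; rewrite normr_ge0.
Qed.

Lemma norm_le_enorm x : `|x| <= enorm x.
Proof.
rewrite [`|x|]mx_normrE; apply/bigmax_leP; split; first exact: enorm_ge0.
by move=> [i j] _ /=; rewrite ord1; exact: coord_enorm.
Qed.

Lemma enorm_le_norm x : enorm x <= n%:R * `|x|.
Proof.
apply: (le_trans (enorm_le_sum x)).
rewrite -[n in n%:R]card_ord -sumr_const mulr_suml; apply: ler_sum => i _.
by rewrite mul1r [`|x|]mx_normrE; apply: (le_bigmax _ _ (0, i)).
Qed.

Lemma ler_dist_enorm x y : `|enorm x - enorm y| <= enorm (x - y).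
Proof.
have H (u v : 'rV[R]_n) : enorm u - enorm v <= enorm (u - v).
  by rewrite lerBlDr; have := enormD (u - v) v; rewrite subrK.
by rewrite ler_norml H andbT lerNl opprB enormB H.
Qed.

(** The topology is that of the sup norm, and [enorm_le_norm] bounds the Euclidean norm by n times
    it. This gives the radius chosen below, where [+ 1] keeps the divisor positive. *)
Lemma lipschitz_enorm_continuous (f : 'rV[R]_n -> R) r :
  (forall x y, `|f x - f y| <= r * enorm (x - y)) -> continuous f.
Proof.
move=> fr /= x s /= /(nbhs_ballP (f x))[e e0 es].
have c0 : 0 < n%:R * `|r| + 1 by rewrite ltr_wpDl// mulr_ge0.
apply/nbhs_ballP; exists (e / (n%:R * `|r| + 1)) => /=; first by rewrite divr_gt0.
move=> y; rewrite mx_norm_ball /ball_ /= => xy; apply: es; rewrite /ball/=.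
apply: (le_lt_trans (fr x y)).
move: xy; rewrite ltr_pdivlMr// mulrC; apply: le_lt_trans.
apply: (@le_trans _ _ (`|r| * (n%:R * `|x - y|))).
  apply: (@le_trans _ _ (`|r| * enorm (x - y))).
    by rewrite ler_wpM2r ?enorm_ge0// ler_norm.
  by rewrite ler_wpM2l// enorm_le_norm.
by rewrite mulrA [`|r| * _]mulrC ler_wpM2r// lerDl.
Qed.

Lemma enorm_dist_continuous z : continuous (fun x : 'rV[R]_n => enorm (z - x)).
Proof.
apply: (@lipschitz_enorm_continuous _ 1) => x y; rewrite mul1r.
have := ler_dist_enorm (z - x) (z - y).
by rewrite opprD opprK addrACA subrr add0r (addrC (- x)) (enormB x).
Qed.

Lemma enorm_continuous : continuous (@enorm R n).
Proof.
by apply: (@lipschitz_enorm_continuous _ 1) => x y; rewrite mul1r ler_dist_enorm.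
Qed.

Lemma dilate_eballE r : 0 <= r ->
  dilate r (@eball R n) = [set x | enorm x <= r].
Proof.
move=> r0; apply/seteqP; split => x /=.
  by move=> [y /= y1 <-]; rewrite enormZ ger0_norm// ler_piMr.
move=> xr; have [r00|rn0] := eqVneq r 0.
  exists 0; first by rewrite /eball/= enorm0.
  rewrite scaler0; apply/esym/enorm_eq0/eqP; rewrite eq_le enorm_ge0 andbT.
  by rewrite -r00.
have rp : 0 < r by rewrite lt_def rn0.
exists (r^-1 *: x); last by rewrite scalerA divff// scale1r.
by rewrite /eball/= enormZ ger0_norm ?invr_ge0// mulrC ler_pdivrMr// mul1r.
Qed.

Lemma compact_enorm_le r : compact [set x : 'rV[R]_n | enorm x <= r].
Proof.
apply: bounded_closed_compact.
  exists r; split; first exact: num_real.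
  move=> M rM x /= xr; apply: (le_trans (norm_le_enorm x)).
  exact: (le_trans xr (ltW rM)).
apply: (@closed_comp _ _ (@enorm R n) [set t | t <= r]); last exact: closed_le.
by move=> x _; exact: enorm_continuous.
Qed.

End euclidean.

(** * Operations on convex bodies and the distance to a body *)

Section bodies.
Variables (R : realType) (n : nat).
Implicit Types (x y z : 'rV[R]_n) (a b r t : R) (A B K : set 'rV[R]_n).

Lemma convex_setP A : convex_set A <->
  forall x y t, 0 <= t <= 1 -> A x -> A y -> A (t *: x + (1 - t) *: y).
Proof.
split=> [cA x y t t01 Ax Ay|cA x y t].
  have := cA x y (Itv01 (andP t01).1 (andP t01).2) (mem_set Ax) (mem_set Ay).
  by rewrite inE.
rewrite !inE => Ax Ay; apply: cA => //.
by rewrite ge0 le1.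
Qed.

Lemma convex_minkowski_add A B : convex_set A -> convex_set B ->
  convex_set (minkowski_add A B).
Proof.
move=> /convex_setP cA /convex_setP cB; apply/convex_setP => u v t t01.
move=> [x Ax [y By <-]] [x' Ax' [y' By' <-]].
exists (t *: x + (1 - t) *: x'); first exact: cA.
exists (t *: y + (1 - t) *: y'); first exact: cB.
by rewrite !scalerDr addrACA.
Qed.

Lemma convex_minkowski_sub A B : convex_set A -> convex_set B ->
  convex_set (minkowski_sub A B).
Proof.
move=> /convex_setP cA /convex_setP cB; apply/convex_setP => u v t t01.
move=> [x Ax [y By <-]] [x' Ax' [y' By' <-]].
exists (t *: x + (1 - t) *: x'); first exact: cA.
exists (t *: y + (1 - t) *: y'); first exact: cB.
by rewrite !scalerBr opprD addrACA.
Qed.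

Lemma convex_dilate a A : convex_set A -> convex_set (dilate a A).
Proof.
move=> /convex_setP cA; apply/convex_setP => u v t t01 [x Ax <-] [y Ay <-].
exists (t *: x + (1 - t) *: y); first exact: cA.
by rewrite scalerDr !scalerA ![a * _]mulrC.
Qed.

Lemma convex_setI_rV A B : convex_set A -> convex_set B -> convex_set (A `&` B).
Proof.
move=> /convex_setP cA /convex_setP cB; apply/convex_setP => x y t t01.
by move=> [Ax Bx] [Ay By]; split; [exact: cA|exact: cB].
Qed.

Lemma convex_eball : convex_set (@eball R n).
Proof.
apply/convex_setP => x y t /andP[t0 t1] x1 y1; rewrite /eball /=.
apply: (le_trans (enormD _ _)); rewrite !enormZ !ger0_norm ?subr_ge0//.
move: x1 y1; rewrite /eball/=; nra.
Qed.

Lemma compact_minkowski_add A B : compact A -> compact B ->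
  compact (minkowski_add A B).
Proof.
move=> cA cB.
have -> : minkowski_add A B = (fun p => p.1 + p.2) @` (A `*` B).
  apply/seteqP; split => x /=; first by move=> [y Ay [z Bz <-]]; exists (y, z).
  by move=> [[y z] [/= Ay Bz] <-]; exists y => //; exists z.
apply: continuous_compact; last exact: compact_setX.
apply: continuous_subspaceT => p; exact: add_continuous.
Qed.

Lemma compact_dilate a A : compact A -> compact (dilate a A).
Proof.
move=> cA; apply: continuous_compact => //.
by apply: continuous_subspaceT => x; exact: scaler_continuous.
Qed.

Lemma minkowski_subE A B : minkowski_sub A B = minkowski_add A (dilate (-1) B).
Proof.
apply/seteqP; split => z [x Ax].
  by move=> [y By <-]; exists x => //; exists (- y) => //; exists y => //; rewrite scaleN1r.
by move=> [_ [y By <-] <-]; exists x => //; exists y => //; rewrite scaleN1r.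
Qed.

Lemma compact_minkowski_sub A B : compact A -> compact B ->
  compact (minkowski_sub A B).
Proof.
by move=> cA cB; rewrite minkowski_subE; apply/compact_minkowski_add/compact_dilate.
Qed.

Lemma compact_eball : compact (@eball R n).
Proof. exact: compact_enorm_le. Qed.

Lemma compact_closed_rV A : compact A -> closed A.
Proof. by apply: compact_closed; exact: norm_hausdorff. Qed.

Lemma compact_setI_rV A B : compact A -> compact B -> compact (A `&` B).
Proof. by move=> cA /compact_closed_rV; exact: compact_closedI. Qed.

Lemma compact_enorm_bounded A : compact A ->
  exists2 r, 0 < r & A `<=` [set x | enorm x <= r].
Proof.
move=> cA; have [->|A0] := pselect (A = set0); first by exists 1.
have [||c _ cmax] := @EVT_max_rV R n (@enorm R n) A _ cA.
- exact/set0P/eqP.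
- by apply: continuous_subspaceT; exact: enorm_continuous.
exists (enorm c + 1); first by rewrite ltr_wpDl// enorm_ge0.
by move=> x Ax /=; rewrite (le_trans (cmax x (mem_set Ax)))// lerDl.
Qed.

(** On the empty set the infimum takes its default value 0, so [edist set0] vanishes identically;
    the formulas relating it to volumes are stated for nonempty sets. *)
Definition edist K x : R := inf [set enorm (x - k) | k in K].

Lemma edist_ge0 K x : 0 <= edist K x.
Proof.
have [->|/eqP/set0P[k Kk]] := pselect (K = set0); first by rewrite /edist image_set0 inf0.
by apply: lb_le_inf; [exists (enorm (x - k)); exists k|move=> _ [y _ <-]; exact: enorm_ge0].
Qed.

Lemma edist_le K x k : K k -> edist K x <= enorm (x - k).
Proof.
move=> Kk; apply: ge_inf; last by exists k.
by exists 0 => _ [y _ <-]; exact: enorm_ge0.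
Qed.

Lemma edist_attained K x : K !=set0 -> compact K ->
  exists2 k, K k & edist K x = enorm (x - k).
Proof.
move=> K0 cK.
have [|k] := @EVT_min_rV R n (fun k => enorm (x - k)) K K0 cK.
  by apply: continuous_subspaceT; exact: enorm_dist_continuous.
rewrite inE => Kk kmin; exists k => //; apply/eqP; rewrite eq_le edist_le//=.
apply: lb_le_inf; first by case: K0 => y Ky; exists (enorm (x - y)); exists y.
by move=> _ [y Ky <-]; apply: kmin; rewrite inE.
Qed.

(** The distance is attained, so the closed inequality describes the parallel body exactly. This
    links Steiner's formula, about Minkowski sums, to the layer cake formula, about sublevel
    sets. *)
Lemma minkowski_add_ballE K r : K !=set0 -> compact K -> 0 <= r ->
  minkowski_add K (dilate r (@eball R n)) = [set x | edist K x <= r].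
Proof.
move=> K0 cK r0; rewrite dilate_eballE//; apply/seteqP; split => x /=.
  move=> [k Kk [y /= yr <-]]; apply: (le_trans (edist_le _ Kk)).
  by rewrite addrAC subrr add0r.
have [k Kk ->] := edist_attained x K0 cK => xk.
by exists k => //; exists (x - k) => //; rewrite addrC subrK.
Qed.

End bodies.

(** * Measurability and finite volume of compact sets *)

Section measurable_bodies.
Variables (R : realType) (n : nat).
Implicit Types (x y z : 'rV[R]_n) (a b r : R) (A B K : set 'rV[R]_n).

Lemma measurable_rV_box (F : 'I_n -> set R) :
  (forall i, measurable (F i)) ->
  measurable [set x : 'rV[R]_n | forall i, F i (x 0 i)].
Proof.
move=> mF.
have -> : [set x : 'rV[R]_n | forall i, F i (x 0 i)] =
    \bigcap_(i in [set: 'I_n]) ((fun x : 'rV[R]_n => x 0 i) @^-1` F i).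
  by apply/seteqP; split => x /= H i => [_|]; exact: H.
apply: fin_bigcap_measurable; first exact: finite_finset.
move=> i _; rewrite -[X in measurable X]setTI.
by apply: (@measurable_rV_coord R n i).
Qed.

Lemma measurable_rV_cube a b :
  measurable [set x : 'rV[R]_n | forall i, a <= x 0 i <= b].
Proof.
have := @measurable_rV_box (fun=> `[a, b]%classic) (fun=> measurable_itv _).
by congr measurable; apply/seteqP; split => x /= H i; have := H i; rewrite in_itv.
Qed.

(** An open set is the union of those cubes with rational centre and radius 1/(m+1) that it
    contains, and there are countably many such cubes. *)
Lemma open_measurable_rV A : open A -> measurable A.
Proof.
move=> oA.
pose Q (p : 'rV[rat]_n * nat) : set 'rV[R]_n :=
  [set x | forall i, `|x 0 i - ratr (p.1 0 i)| < p.2.+1%:R^-1].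
have -> : A = \bigcup_p (if `[< Q p `<=` A >] then Q p else set0).
  apply/seteqP; split => x; last first.
    by move=> [p _]; case: ifPn => // /asboolP; exact.
  move=> Ax; have /nbhs_ballP[e /= e0 eA] := open_nbhs_nbhs (conj oA Ax).
  (* Half of [e], because x and an arbitrary point of the cube are each within [s] of its centre in
     every coordinate. *)
  have [m [s [sE s0 se]]] : exists m (s : R), [/\ s = m.+1%:R^-1, 0 < s & s < e / 2].
    have [m _ H] := near_infty_natSinv_lt (PosNum (divr_gt0 e0 (ltr0Sn R 1))).
    by exists m, m.+1%:R^-1; split => //; exact: H m (leqnn m).
  have q_ i : {q : rat | `|x 0 i - ratr q| < s}.
    apply: cid; have : x 0 i - s < x 0 i + s by lra.
    move=> /rat_in_itvoo[q]; rewrite in_itv/= => /andP[q1 q2].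
    by exists q; rewrite ltr_norml; lra.
  pose p : 'rV[rat]_n * nat := (\row_i sval (q_ i), m).
  have Qp : Q p `<=` A.
    move=> y Qy; apply: eA; rewrite mx_norm_ball /ball_ /=.
    have H : `|x - y| <= 2 * s.
      rewrite [`|_|]mx_normrE; apply/bigmax_leP; split; first by rewrite mulr_ge0// ltW.
      move=> [j i] _ /=; rewrite !mxE ord1.
      have := Qy i; rewrite /p /= mxE -sE; have := svalP (q_ i).
      by rewrite !ltr_norml ler_norml; lra.
    by apply: (le_lt_trans H); lra.
  by exists p => //; rewrite ifT; [move=> i; rewrite mxE -sE; exact: (svalP (q_ i))|apply/asboolP].
apply: countable_bigcupT_measurable; first exact: countableP.
move=> p; case: ifPn => // _.
apply: (@measurable_rV_box (fun i => [set t | `|t - ratr (p.1 0 i)| < p.2.+1%:R^-1])) => i.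
rewrite (_ : mkset _ = ball (ratr (p.1 0 i) : R) p.2.+1%:R^-1); first exact: measurable_ball.
by apply/seteqP; split => t; rewrite /ball/= distrC.
Qed.

Lemma closed_measurable_rV A : closed A -> measurable A.
Proof. by move=> /closed_openC/open_measurable_rV/measurableC; rewrite setCK. Qed.

Lemma compact_measurable_rV A : compact A -> measurable A.
Proof. by move=> /compact_closed_rV/closed_measurable_rV. Qed.

Lemma measurable_enorm_le r : measurable [set x : 'rV[R]_n | enorm x <= r].
Proof. by apply: compact_measurable_rV; exact: compact_enorm_le. Qed.

Lemma vol_enorm_le_lty r : (@vol R n [set x | (enorm x <= r)%R] < +oo)%E.
Proof.
have [r0|r0] := ltP r 0.
  rewrite (_ : mkset _ = set0) ?measure0// -subset0 => x /= xr.
  by have := lt_le_trans r0 (enorm_ge0 x); rewrite ltNge xr.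
apply: (@le_lt_trans _ _ (@vol R n [set x | forall i, (- r <= x 0 i <= r)])).
  apply: le_measure; rewrite ?inE//; first exact: measurable_enorm_le.
    exact: measurable_rV_cube.
  move=> x /= xr i; rewrite -ler_norml.
  exact: (le_trans (coord_enorm x i)).
by rewrite vol_box ?ltry//; lra.
Qed.

Lemma vol_compact_lty A : compact A -> (@vol R n A < +oo)%E.
Proof.
move=> cA; have [r r0 Ar] := compact_enorm_bounded cA.
apply: le_lt_trans (vol_enorm_le_lty r).
apply: le_measure; rewrite ?inE//; first exact: compact_measurable_rV.
exact: measurable_enorm_le.
Qed.

Lemma vol_compact_fin_num A : compact A -> (@vol R n A \is a fin_num)%E.
Proof. by move=> cA; rewrite ge0_fin_numE// vol_compact_lty. Qed.

Lemma measurable_edist K : K !=set0 -> compact K ->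
  measurable_fun setT (edist K).
Proof.
move=> K0 cK; apply: (measurability _ (RGenOInfty.measurableE R)).
move=> _ [_ [r ->] <-]; rewrite setTI.
have -> : edist K @^-1` `]r, +oo[%classic = ~` [set x | edist K x <= r].
  apply/seteqP; split => x /=; rewrite in_itv/= andbT.
    by move=> rx; apply/negP; rewrite -ltNge.
  by move/negP; rewrite -ltNge.
apply: measurableC.
have [r0|r0] := ltP r 0.
  rewrite (_ : mkset _ = set0) // -subset0 => x /= xr.
  by have := lt_le_trans r0 (edist_ge0 K x); rewrite ltNge xr.
rewrite -minkowski_add_ballE//; apply: compact_measurable_rV.
exact/compact_minkowski_add/compact_dilate/compact_eball.
Qed.

Lemma kappa_gt0 : 0 < kappa R n.
Proof.
rewrite /kappa fine_gt0// vol_compact_lty ?andbT; last exact: compact_eball.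
(* The cube [0, s]^n lies in the ball, its points having coordinate sum at most n/(n+1). Taking n+1
   instead of n keeps [s] positive in dimension 0. *)
pose s : R := n.+1%:R^-1.
have s0 : 0 < s by rewrite invr_gt0.
apply: (@lt_le_trans _ _ (@vol R n [set x | forall i, (0 <= x 0 i <= s)])).
  by rewrite vol_box ?ltW// lte_fin subr0 exprn_gt0.
apply: le_measure; rewrite ?inE//; last 2 first.
- by apply: compact_measurable_rV; exact: compact_eball.
- move=> x /= xs; rewrite /eball/=; apply: (le_trans (enorm_le_sum x)).
  apply: (@le_trans _ _ (\sum_(i < n) s)).
    by apply: ler_sum => i _; have := xs i; case/andP => ? ?; rewrite ger0_norm.
  rewrite sumr_const card_ord -[X in X <= _]mulr_natl /s ler_pdivrMr// mul1r.
  by rewrite ler_nat.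
exact: measurable_rV_cube.
Qed.

End measurable_bodies.
(** * Volume of parallel bodies along zonotopes *)

Section steiner_polynomial.
Variables (R : realType) (n : nat).
Implicit Types (x y z v : 'rV[R]_n) (a b r t : R) (A B K Z : set 'rV[R]_n).

(** Faithful only where the volume is finite, as on compact sets ([rvolE]): [fine] sends infinity to
    0. *)
Definition rvol A : R := fine (@vol R n A).

Lemma rvol_ge0 A : 0 <= rvol A.
Proof. exact: fine_ge0. Qed.

Lemma rvolE A : compact A -> @vol R n A = (rvol A)%:E.
Proof. by move=> cA; rewrite fineK// vol_compact_fin_num. Qed.

Lemma le_rvol A B : compact A -> compact B -> A `<=` B -> rvol A <= rvol B.
Proof.
move=> cA cB AB; rewrite -lee_fin -!rvolE//.
by apply: le_measure; rewrite ?inE//; apply: compact_measurable_rV.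
Qed.

Lemma rvol_affine a v A : 0 < a -> compact A ->
  rvol [set a *: x + v | x in A] = a ^+ n * rvol A.
Proof.
move=> a0 cA; pose B := [set a *: x + v | x in A].
have cB : compact B.
  rewrite (_ : B = minkowski_add (dilate a A) [set v]); last first.
    apply/seteqP; split => x /=.
      by move=> [y Ay <-]; exists (a *: y); [exists y|exists v].
    by move=> [_ [y Ay <-] [_ -> <-]]; exists y.
  by apply: compact_minkowski_add; [exact: compact_dilate|exact: compact_set1].
apply/EFin_inj; rewrite EFinM -!rvolE//.
rewrite (@vol_affine R n a v B a0); last exact: compact_measurable_rV.
congr (_ * @vol R n _)%E; apply/seteqP; split => x /=; last by move=> Ax; exists x.
move=> [y Ay /addIr /(congr1 (fun z => a^-1 *: z))].
by rewrite !scalerA mulVf ?gt_eqF// !scale1r => <-.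
Qed.

Lemma rvol_dilate a A : 0 < a -> compact A ->
  rvol (dilate a A) = a ^+ n * rvol A.
Proof.
move=> a0 cA; rewrite -(@rvol_affine a 0)//; congr rvol.
by apply/seteqP; split => x [y Ay <-]; exists y; rewrite ?addr0.
Qed.

Lemma rvol_translate v A : compact A -> rvol [set x + v | x in A] = rvol A.
Proof.
move=> cA; rewrite -[RHS]mul1r -(expr1n R n) -(@rvol_affine 1 v)//; congr rvol.
by apply/seteqP; split => x [y Ay <-]; exists y; rewrite ?scale1r.
Qed.

Lemma minkowski_addA A B K :
  minkowski_add A (minkowski_add B K) = minkowski_add (minkowski_add A B) K.
Proof.
apply/seteqP; split => z.
  move=> [x Ax [_ [y By [w Kw <-]] <-]]; exists (x + y); last by exists w => //; rewrite addrA.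
  by exists x => //; exists y.
move=> [_ [x Ax [y By <-]] [w Kw <-]]; exists x => //.
by exists (y + w); [exists y => //; exists w|rewrite addrA].
Qed.

Lemma minkowski_addC A B : minkowski_add A B = minkowski_add B A.
Proof.
by apply/seteqP; split => z [x Ax [y By <-]]; exists y => //; exists x => //; rewrite addrC.
Qed.

Lemma minkowski_add0 A : minkowski_add A [set 0] = A.
Proof.
apply/seteqP; split => z.
  by move=> [x Ax [_ -> <-]]; rewrite addr0.
by move=> Az; exists z => //; exists 0 => //; rewrite addr0.
Qed.

Lemma dilate_minkowski_add a A B :
  dilate a (minkowski_add A B) = minkowski_add (dilate a A) (dilate a B).
Proof.
apply/seteqP; split => z.
  move=> [_ [x Ax [y By <-]] <-]; exists (a *: x); first by exists x.
  by exists (a *: y); [exists y|rewrite scalerDr].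
move=> [_ [x Ax <-] [_ [y By <-] <-]]; exists (x + y); last by rewrite scalerDr.
by exists x => //; exists y.
Qed.

Lemma dilate0 a : dilate a [set (0 : 'rV[R]_n)] = [set 0].
Proof.
apply/seteqP; split => z; first by move=> [_ -> <-]; rewrite scaler0.
by move=> ->; exists 0 => //; rewrite scaler0.
Qed.

Lemma minkowski_addS A B A' B' : A `<=` A' -> B `<=` B' ->
  minkowski_add A B `<=` minkowski_add A' B'.
Proof. by move=> AA BB z [x Ax [y By <-]]; exists x; [exact: AA|exists y => //; exact: BB]. Qed.

Lemma dilateS a A B : A `<=` B -> dilate a A `<=` dilate a B.
Proof. by move=> AB z [x Ax <-]; exists x => //; exact: AB. Qed.

Definition segment v : set 'rV[R]_n := [set t *: v | t in `[0, 1]%classic].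

Lemma compact_segment v : compact (segment v).
Proof.
apply: continuous_compact; last exact: segment_compact.
apply: continuous_subspaceT => t; exact: scalel_continuous.
Qed.

Lemma convex_segment v : convex_set (segment v).
Proof.
apply/convex_setP => x y t /andP[t0 t1] [a + <-] [b + <-].
rewrite /= !in_itv/= => /andP[a0 a1] /andP[b0 b1].
exists (t * a + (1 - t) * b); last by rewrite !scalerA scalerDl.
by rewrite /= in_itv/=; apply/andP; split; nra.
Qed.

Lemma sweepE K v r : 0 <= r -> minkowski_add K (dilate r (segment v)) =
  [set x | exists k t, [/\ K k, 0 <= t <= r & x = k + t *: v]].
Proof.
move=> r0; apply/seteqP; split => z /=.
  move=> [k Kk [_ [_ [t + <-] <-] <-]]; rewrite /= in_itv/= => /andP[t0 t1].
  exists k, (r * t); split => //; last by rewrite scalerA.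
  by rewrite mulr_ge0//= ler_piMr.
move=> [k [t [Kk /andP[t0 tr] ->]]]; exists k => //.
exists (t *: v) => //; have [rn|r1] := eqVneq r 0.
  exists 0; first by exists 0; rewrite ?scale0r//= in_itv/= lexx ler01.
  rewrite scaler0; have -> : t = 0 by apply/eqP; rewrite eq_le t0 andbT -rn.
  by rewrite scale0r.
exists ((t / r) *: v); last by rewrite scalerA mulrCA divff// mulr1.
exists (t / r) => //=; rewrite in_itv/= divr_ge0//= ler_pdivrMr ?mul1r//.
by rewrite lt_def r1.
Qed.

Definition sweep K v r := minkowski_add K (dilate r (segment v)).

Lemma compact_sweep K v r : compact K -> compact (sweep K v r).
Proof.
by move=> cK; apply: compact_minkowski_add => //; apply: compact_dilate; exact: compact_segment.
Qed.

Lemma sweep0 K v : sweep K v 0 = K.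
Proof.
rewrite /sweep sweepE//; apply/seteqP; split => z /=.
  move=> [k [t [Kk t0 ->]]]; have -> : t = 0 by apply/eqP; rewrite eq_le andbC.
  by rewrite scale0r addr0.
by move=> Kz; exists z, 0; rewrite lexx scale0r addr0.
Qed.

Lemma subset_sweep K v a b : 0 <= a -> 0 <= b -> sweep K v a `<=` sweep K v (a + b).
Proof.
move=> a0 b0; rewrite /sweep !sweepE ?addr_ge0// => x [k [t [Kk /andP[t0 ta] ->]]].
by exists k, t; split => //; rewrite t0/= (le_trans ta)// lerDl.
Qed.

(* On a line parallel to v, a convex body is a segment and sweeping it along v
   only moves its far end. *)
Lemma sweepD K v a b : convex_set K -> 0 <= a -> 0 <= b ->
  sweep K v (a + b) `\` sweep K v a =
  [set x + a *: v | x in sweep K v b `\` K].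
Proof.
move=> /convex_setP cK a0 b0; rewrite /sweep !sweepE ?addr_ge0//.
apply/seteqP; split => x /=.
  move=> [[k [t [Kk /andP[t0 tab] ->]]] H].
  have at_ : a < t.
    by rewrite ltNge; apply/negP => ta; apply: H; exists k, t; rewrite t0.
  exists (k + (t - a) *: v); last by rewrite -addrA -scalerDl subrK.
  split; first by exists k, (t - a); rewrite subr_ge0 ltW//= lerBlDl.
  move=> Kx; apply: H; exists (k + (t - a) *: v), a; rewrite a0 lexx; split => //.
  by rewrite -addrA -scalerDl subrK.
move=> [_ [[k [t [Kk /andP[t0 tb] ->]]] H] <-]; split.
  exists k, (t + a); split => //; last by rewrite -addrA -scalerDl.
  by rewrite addr_ge0//= addrC lerD2l.
move=> [k' [s [Kk' /andP[s0 sa] E]]]; apply: H.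
have E' : k + t *: v = k' - (a - s) *: v.
  by rewrite scalerBl opprB addrA -E addrK.
(* A translate already swept by time a would place the point between k and k' = k + (t + a - s) v,
   hence in K by convexity. If t + a - s vanishes, then so does t. *)
have [ts|ts] := eqVneq (t + (a - s)) 0.
  by rewrite (_ : t = 0) ?scale0r ?addr0//; lra.
have ts0 : 0 < t + (a - s) by rewrite lt_def ts/=; lra.
have -> : k + t *: v =
    (t / (t + (a - s))) *: k' + (1 - t / (t + (a - s))) *: k.
  have -> : k' = k + (t + (a - s)) *: v.
    by rewrite scalerDl addrA E' subrK.
  by rewrite scalerDr scalerA divfK// scalerBl scale1r addrAC (addrC (_ *: k)) subrK.
apply: cK => //; rewrite divr_ge0 ?(ltW ts0)//= ler_pdivrMr// mul1r; lra.
Qed.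

(** Cauchy's functional equation: nonnegativity makes g monotone, and trapping m a between
    consecutive integers bounds m |g a - a g 1| by g 1 for every integer m. *)
Lemma additive_nonneg_linear (g : R -> R) :
  (forall a b, 0 <= a -> 0 <= b -> g (a + b) = g a + g b) ->
  (forall a, 0 <= a -> 0 <= g a) -> forall a, 0 <= a -> g a = a * g 1.
Proof.
move=> gD g0 a a0.
have gM (m : nat) b : 0 <= b -> g (m%:R * b) = m%:R * g b.
  move=> b0; elim: m => [|m IH].
    by rewrite !mul0r; have := gD 0 0 (lexx _) (lexx _); rewrite addr0; lra.
  by rewrite -natr1 !mulrDl !mul1r gD ?mulr_ge0// IH.
have g_mono b c : 0 <= b -> b <= c -> g b <= g c.
  by move=> b0 bc; rewrite -[c](subrK b) addrC gD ?subr_ge0// lerDl g0// subr_ge0.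
have g1 : 0 <= g 1 by exact: g0.
have key (m : nat) : m%:R * `|g a - a * g 1| <= g 1.
  have ma0 : 0 <= m%:R * a by rewrite mulr_ge0.
  have /andP[l u] := truncn_itv ma0.
  move: l u; set k := Num.truncn _ => l u.
  have H1 : k%:R * g 1 <= m%:R * g a.
    by rewrite -!gM// mulr1; apply: g_mono.
  have H2 : m%:R * g a <= k.+1%:R * g 1.
    by rewrite -!gM// mulr1; apply: g_mono => //; exact: ltW.
  rewrite -[m%:R]ger0_norm// -normrM ler_norml; apply/andP.
  by rewrite -natr1 in u H2; split; nra.
apply/eqP; rewrite -subr_eq0 -normr_le0 leNgt; apply/negP => d0.
set d := `|_| in d0 key.
have := key (Num.truncn (g 1 / d)).+1.
have := truncnS_gt (g 1 / d); rewrite ltr_pdivrMr// => u l.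
by have := lt_le_trans u l; rewrite ltxx.
Qed.

Lemma rvolB A B : compact A -> compact B -> A `<=` B ->
  rvol B - rvol A = fine (@vol R n (B `\` A)).
Proof.
move=> cA cB AB; have mA := compact_measurable_rV cA.
have mB := compact_measurable_rV cB.
apply: EFin_inj; rewrite fineK; last first.
  rewrite ge0_fin_numE//; apply: le_lt_trans (vol_compact_lty cB).
  by apply: le_measure; rewrite ?inE//; exact: measurableD.
rewrite EFinB -!rvolE// (measureD mB mA) ?setIidr//.
exact: vol_compact_lty.
Qed.

Lemma vol_translate v A : measurable A ->
  @vol R n [set x + v | x in A] = @vol R n A.
Proof.
move=> mA; rewrite [RHS](@vol_affine R n 1 (- v))// expr1n mul1e; congr vol.
apply/seteqP; split => x /=; rewrite scale1r.
  by move=> [y Ay <-]; rewrite addrK.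
by move=> Ax; exists (x - v) => //; rewrite subrK.
Qed.

Lemma rvol_sweep K v r : compact K -> convex_set K -> 0 <= r ->
  rvol (sweep K v r) = rvol K + r * (rvol (sweep K v 1) - rvol K).
Proof.
move=> cK xK r0; pose g r := rvol (sweep K v r) - rvol K.
have gD a b : 0 <= a -> 0 <= b -> g (a + b) = g a + g b.
  move=> a0 b0.
  suff : rvol (sweep K v (a + b)) - rvol (sweep K v a) =
         rvol (sweep K v b) - rvol K by rewrite /g; lra.
  rewrite rvolB; [|exact: compact_sweep..|exact: subset_sweep].
  have Kb : K `<=` sweep K v b.
    by rewrite -{1}(sweep0 K v) -[b]add0r; exact: subset_sweep.
  rewrite sweepD// vol_translate ?rvolB//; first exact: compact_sweep.
  by apply: measurableD; apply: compact_measurable_rV => //; exact: compact_sweep.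
have g0 a : 0 <= a -> 0 <= g a.
  move=> a0; rewrite subr_ge0; apply: le_rvol => //; first exact: compact_sweep.
  by rewrite -{1}(sweep0 K v) -[a]add0r; exact: subset_sweep.
have := additive_nonneg_linear gD g0 r0; rewrite /g; lra.
Qed.

Definition zonotope (s : seq 'rV[R]_n) : set 'rV[R]_n :=
  foldr (fun v Z => minkowski_add (segment v) Z) [set 0] s.

Lemma compact_zonotope s : compact (zonotope s).
Proof.
elim: s => [|v s IH] /=; first exact: compact_set1.
by apply: compact_minkowski_add => //; exact: compact_segment.
Qed.

Lemma convex_zonotope s : convex_set (zonotope s).
Proof.
elim: s => [|v s IH] /=; last first.
  by apply: convex_minkowski_add => //; exact: convex_segment.
by apply/convex_setP => x y t _ /= -> ->; rewrite !scaler0 addr0.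
Qed.

Lemma zonotope0 s : zonotope s 0.
Proof.
elim: s => [//|v s IH] /=; exists 0; last by exists 0; rewrite ?addr0.
by exists 0; rewrite ?scale0r//= in_itv/= lexx ler01.
Qed.

(** The induction is over all K at once, because adding one segment calls the hypothesis both for K
    and for K + [0, v]. *)
Lemma rvol_add_zonotope s K : compact K -> convex_set K ->
  exists p : {poly R}, forall r, 0 <= r ->
    rvol (minkowski_add K (dilate r (zonotope s))) = p.[r].
Proof.
elim: s K => [|v s IH] K cK xK.
  by exists (rvol K)%:P => r r0; rewrite /= dilate0 minkowski_add0 hornerC.
have [p pE] := IH K cK xK.
have [|//|q qE] := IH (sweep K v 1); first exact: compact_sweep.
  by apply: convex_minkowski_add => //; apply: convex_dilate; exact: convex_segment.
(* With K' = K + rZ, the volume of K' + r[0, v] is affine in the second r, with value p(r) at time 0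
   and q(r) at time 1. *)
exists (p + 'X * (q - p)) => r r0 /=.
rewrite !hornerE -pE// -qE//; set K' := minkowski_add K (dilate r (zonotope s)).
have -> : minkowski_add K (dilate r (minkowski_add (segment v) (zonotope s))) =
    sweep K' v r.
  by rewrite dilate_minkowski_add (minkowski_addC (dilate r (segment v))) minkowski_addA.
have -> : minkowski_add (sweep K v 1) (dilate r (zonotope s)) = sweep K' v 1.
  by rewrite /sweep /K' -!minkowski_addA; congr minkowski_add; rewrite minkowski_addC.
apply: rvol_sweep => //.
  by apply: compact_minkowski_add => //; apply: compact_dilate; exact: compact_zonotope.
by apply: convex_minkowski_add => //; apply: convex_dilate; exact: convex_zonotope.
Qed.

Lemma dilate_scale_convex a b A : convex_set A -> A 0 -> 0 <= a -> a <= b ->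
  dilate a A `<=` dilate b A.
Proof.
move=> /convex_setP xA A0 a0 ab x [y Ay <-].
have [b0|b0] := eqVneq b 0.
  by exists y => //; congr (_ *: _); apply/eqP; rewrite eq_le ab b0 a0.
exists ((a / b) *: y); last by rewrite scalerA mulrCA divff// mulr1.
have bp : 0 < b by rewrite lt_def b0 (le_trans a0 ab).
have := xA y 0 (a / b); rewrite scaler0 addr0; apply => //.
by rewrite divr_ge0 ?(ltW bp)//= ler_pdivrMr// mul1r.
Qed.

Lemma dilate1 A : dilate 1 A = A.
Proof.
apply/seteqP; split => x; first by move=> [y Ay <-]; rewrite scale1r.
by move=> Ax; exists x; rewrite ?scale1r.
Qed.

(** As 0 is in K and b >= 1, K is contained in bK, so K + baZ is contained in b(K + aZ). This yields
    both the growth bound in r and the cost of passing from the ball to its dilate by 1 + e. *)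
Lemma rvol_add_dilate_le K Z a b : compact K -> compact Z -> convex_set K ->
  convex_set Z -> K 0 -> Z 0 -> 0 <= a -> 1 <= b -> 
  rvol (minkowski_add K (dilate (b * a) Z)) <= b ^+ n * rvol (minkowski_add K (dilate a Z)).
Proof.
move=> cK cZ xK xZ K0 Z0 a0 b1; have b0 : 0 < b by rewrite (lt_le_trans ltr01).
have cKZ c : compact (minkowski_add K (dilate c Z)).
  by apply: compact_minkowski_add => //; exact: compact_dilate.
rewrite -rvol_dilate//; apply: le_rvol => //; first exact: compact_dilate.
rewrite dilate_minkowski_add; apply: minkowski_addS.
  by rewrite -{1}(dilate1 K); exact: dilate_scale_convex.
by move=> x [y Zy <-]; exists (a *: y); [exists y|rewrite scalerA].
Qed.

Lemma rvol_add_growth K Z r : compact K -> compact Z -> convex_set K ->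
  convex_set Z -> K 0 -> Z 0 -> 0 <= r ->
  rvol (minkowski_add K (dilate r Z)) <= (1 + r) ^+ n * rvol (minkowski_add K Z).
Proof.
move=> cK cZ xK xZ K0 Z0 r0.
have := @rvol_add_dilate_le K Z 1 (1 + r) cK cZ xK xZ K0 Z0 ler01.
rewrite dilate1 lerDl => /(_ r0); apply: le_trans; apply: le_rvol.
- by apply: compact_minkowski_add => //; exact: compact_dilate.
- by apply: compact_minkowski_add => //; exact: compact_dilate.
by apply: minkowski_addS => //; apply: dilate_scale_convex; rewrite // mulr1 lerDr.
Qed.

End steiner_polynomial.

(** Were the degree n + d + 1, dividing by x^(n+d) would bound the leading coefficient times x
    uniformly over x >= 1. *)
Lemma size_poly_growth (R : realType) (p : {poly R}) n (C : R) :
  (forall x, 0 <= x -> 0 <= p.[x] <= C * (1 + x) ^+ n) -> (size p <= n.+1)%N.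
Proof.
move=> pC; rewrite leqNgt; apply/negP => sp.
have [d dE] : exists d, size p = (n + d).+2.
  by exists (size p - n.+2)%N; rewrite -[(_ + _).+2]/(n.+2 + _)%N subnKC.
have C0 : 0 <= C.
  by have := pC 0 (lexx _); rewrite addr0 expr1n mulr1 => /andP[]; exact: le_trans.
pose l := lead_coef p.
have l0 : l != 0 by rewrite lead_coef_eq0 -size_poly_eq0 dE.
pose M := \sum_(i < (n + d).+1) `|p`_i|.
have M0 : 0 <= M by apply: sumr_ge0.
have key x : 1 <= x -> `|l| * x <= M + C * 2 ^+ n.
  move=> x1; have x0 : 0 <= x by rewrite (le_trans ler01).
  have xp : 0 < x ^+ (n + d) by rewrite exprn_gt0// (lt_le_trans ltr01).
  have pE : p.[x] = l * x ^+ (n + d).+1 + \sum_(i < (n + d).+1) p`_i * x ^+ i.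
    by rewrite horner_coef dE big_ord_recr/= addrC /l lead_coefE dE.
  have sM : `|\sum_(i < (n + d).+1) p`_i * x ^+ i| <= M * x ^+ (n + d).
    apply: (le_trans (ler_norm_sum _ _ _)); rewrite mulr_suml; apply: ler_sum => i _.
    rewrite normrM; apply: ler_wpM2l => //.
    by rewrite ger0_norm ?exprn_ge0// ler_weXn2l// -ltnS.
  have /andP[p0 pl] := pC x x0.
  (* The factor 2^n comes from 1 + x <= 2x, valid as x >= 1. *)
  have pu : p.[x] <= C * 2 ^+ n * x ^+ (n + d).
    apply: (le_trans pl); rewrite -mulrA; apply: ler_wpM2l => //.
    apply: (@le_trans _ _ ((2 * x) ^+ n)).
      by apply: lerXn2r; rewrite ?nnegrE ?mulr_ge0 ?addr_ge0//; lra.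
    rewrite exprMn; apply: ler_wpM2l; first by rewrite exprn_ge0.
    by apply: ler_weXn2l => //; rewrite leq_addr.
  rewrite -(ler_pM2r xp) -mulrA -exprS -[x ^+ _.+1]ger0_norm ?exprn_ge0// -normrM.
  have -> : l * x ^+ (n + d).+1 = p.[x] - \sum_(i < (n + d).+1) p`_i * x ^+ i.
    by rewrite pE addrK.
  apply: (le_trans (ler_normB _ _)); rewrite (ger0_norm p0) addrC mulrDl.
  exact: lerD.
have lp : 0 < `|l| by rewrite normr_gt0.
have K0 : 0 <= M + C * 2 ^+ n by rewrite addr_ge0// mulr_ge0// exprn_ge0.
have := key ((M + C * 2 ^+ n) / `|l| + 1).
rewrite lerDr divr_ge0// => /(_ isT).
by rewrite mulrDr mulrCA divff ?gt_eqF// !mulr1 gerDl leNgt lp.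
Qed.
(** * Approximating the ball by zonotopes *)

Section support_function.
Variables (R : realType) (n : nat).
Implicit Types (u v w x y z : 'rV[R]_n) (a b c t : R) (s : seq 'rV[R]_n).

(** The support function of [zonotope s]: the segment [0, v] contributes max(0, v.u), and support
    functions add under Minkowski sums. This is established by [dotp_zonotope_le] and
    [zsupp_attained]. *)
Definition zsupp s u : R := \sum_(v <- s) Num.max 0 (dotp v u).

Lemma zsupp_ge0 s u : 0 <= zsupp s u.
Proof. by apply: sumr_ge0 => v _; rewrite le_max lexx. Qed.

Lemma zsuppZ s c u : 0 <= c -> zsupp s (c *: u) = c * zsupp s u.
Proof.
move=> c0; rewrite /zsupp mulr_sumr; apply: eq_bigr => v _.
by rewrite dotpZr maxr_pMr// mulr0.
Qed.

Lemma zsupp_scale s c u : 0 <= c ->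
  zsupp [seq c *: v | v <- s] u = c * zsupp s u.
Proof.
move=> c0; rewrite /zsupp big_map mulr_sumr; apply: eq_bigr => v _.
by rewrite dotpZl maxr_pMr// mulr0.
Qed.

Lemma zsuppD s u w : zsupp s (u + w) <= zsupp s u + zsupp s w.
Proof.
rewrite /zsupp -big_split; apply: ler_sum => v _ /=; rewrite dotpDr.
by rewrite ge_max addr_ge0 ?le_max ?lexx//= lerD// le_max lexx orbT.
Qed.

(** With [zsupp_scale], concatenating rescaled lists averages support functions, so an average of
    zonotopes is again a zonotope. *)
Lemma zsupp_flatten ss u :
  zsupp (flatten ss) u = \sum_(s <- ss) zsupp s u.
Proof. by rewrite /zsupp big_flatten. Qed.

Lemma zsupp_homogeneous_le s c : (forall u, enorm u = 1 -> zsupp s u <= c) ->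
  forall u, zsupp s u <= c * enorm u.
Proof.
move=> H u; have [->|u0] := eqVneq u 0.
  by rewrite -(scale0r 0) zsuppZ// enormZ normr0 !mul0r mulr0.
have e0 : 0 < enorm u.
  by rewrite lt_def enorm_ge0 andbT; apply: contra u0 => /eqP/enorm_eq0 ->.
have := H ((enorm u)^-1 *: u); rewrite zsuppZ ?invr_ge0 ?enorm_ge0//.
rewrite enormZ ger0_norm ?invr_ge0 ?enorm_ge0// mulVf ?gt_eqF// => /(_ erefl).
by rewrite mulrC ler_pdivrMr.
Qed.

Lemma zsupp_homogeneous_ge s c : (forall u, enorm u = 1 -> c <= zsupp s u) ->
  forall u, c * enorm u <= zsupp s u.
Proof.
move=> H u; have [->|u0] := eqVneq u 0.
  by rewrite enorm0 mulr0 zsupp_ge0.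
have e0 : 0 < enorm u.
  by rewrite lt_def enorm_ge0 andbT; apply: contra u0 => /eqP/enorm_eq0 ->.
have := H ((enorm u)^-1 *: u); rewrite zsuppZ ?invr_ge0 ?enorm_ge0//.
rewrite enormZ ger0_norm ?invr_ge0 ?enorm_ge0// mulVf ?gt_eqF// => /(_ erefl).
by rewrite [_^-1 * _]mulrC ler_pdivlMr.
Qed.

Lemma dotp_zonotope_le s x u : zonotope s x -> dotp x u <= zsupp s u.
Proof.
rewrite /zsupp; elim: s x => [|v s IH] x /=; first by move=> ->; rewrite big_nil dotp0l.
move=> [_ [t + <-] [y sy <-]]; rewrite big_cons /= in_itv/= => /andP[t0 t1].
rewrite dotpDl dotpZl; apply: lerD; last exact: IH.
rewrite le_max; have [d0|d0] := lerP (dotp v u) 0.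
  by rewrite mulr_ge0_le0.
by rewrite ler_piMl ?orbT// ltW.
Qed.

Lemma zsupp_attained s u : exists2 x, zonotope s x & dotp x u = zsupp s u.
Proof.
rewrite /zsupp; elim: s => [|v s [y sy yE]] /=.
  by exists 0 => //; rewrite big_nil dotp0l.
have [d0|d0] := lerP (dotp v u) 0.
  exists (0 *: v + y); last by rewrite big_cons dotpDl dotpZl mul0r yE max_l.
  exists (0 *: v); last by exists y.
  by exists 0 => //=; rewrite in_itv/= lexx ler01.
exists (1 *: v + y); last by rewrite big_cons dotpDl dotpZl mul1r yE max_r// ltW.
exists (1 *: v); last by exists y.
by exists 1 => //=; rewrite in_itv/= lexx ler01.
Qed.

(** Moving from p towards z by a fraction t changes the squared distance to x by -2td + t^2 q, which
    must stay nonnegative on [0, 1]. *)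
Lemma nearest_point_dotp (K : set 'rV[R]_n) x p z : convex_set K -> K p -> K z ->
  (forall y, K y -> enorm (x - p) <= enorm (x - y)) -> dotp (x - p) (z - p) <= 0.
Proof.
move=> /convex_setP xK Kp Kz pmin.
set d := dotp _ _; pose q := dotp (z - p) (z - p).
have q0 : 0 <= q by exact: dotpp_ge0.
have key t : 0 <= t <= 1 -> 0 <= - (2 * t * d) + t ^+ 2 * q.
  move=> t01; have := pmin _ (xK z p t t01 Kz Kp); rewrite enorm_le.
  have -> : x - (t *: z + (1 - t) *: p) = (x - p) - t *: (z - p).
    rewrite scalerBl scale1r scalerBr -!addrA; congr (_ + _).
    by rewrite !opprD !opprK addrCA addrA.
  rewrite /d /q; move: (x - p) (z - p) => u w.
  rewrite [X in _ <= X]dotpDl !dotpDr !dotpNl !dotpNr !dotpZl !dotpZr (dotpC w u); lra.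
rewrite leNgt; apply/negP => d0.
(* If d were positive, the quadratic would be negative at its minimiser d/q, or at t = 1 when d/q is
   at least 1 or q = 0. *)
have [qd|dq] := lerP q d.
  by have := key 1; rewrite ler01 lexx => /(_ isT); lra.
have qp : 0 < q by exact: lt_trans dq.
have := key (d / q); rewrite divr_ge0 ?(ltW d0) ?(ltW qp)//= ler_pdivrMr// mul1r ltW//.
move=> /(_ isT); have rq : d / q * q = d by rewrite divfK ?gt_eqF.
have : 0 < d / q by rewrite divr_gt0.
move: rq; set r := d / q => rq r0; rewrite expr2 -[r * r * q]mulrA rq.
by have := mulr_gt0 r0 d0; lra.
Qed.

Lemma zonotope_subset_ball s c : 0 <= c ->
  (forall u, enorm u = 1 -> zsupp s u <= c) ->
  zonotope s `<=` dilate c (@eball R n).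
Proof.
move=> c0 H x sx; rewrite dilate_eballE//=.
have := le_trans (dotp_zonotope_le x sx) (zsupp_homogeneous_le H x).
rewrite -enorm_sqr expr2; have [->|x0] := eqVneq (enorm x) 0; first by rewrite c0.
by rewrite ler_pM2r// lt_def x0 enorm_ge0.
Qed.

(** Separation: for x outside with nearest point p and u = x - p, the support value at u is at most
    p.u, so x.u = p.u + u.u > |u|, against the Cauchy-Schwarz inequality for |x| <= 1. *)
Lemma ball_subset_zonotope s :
  (forall u, enorm u = 1 -> 1 <= zsupp s u) -> @eball R n `<=` zonotope s.
Proof.
move=> H x; rewrite /eball/= => x1; apply: contrapT => nsx.
have [p sp pE] : exists2 p, zonotope s p & edist (zonotope s) x = enorm (x - p).
  by apply: edist_attained; [exists 0; exact: zonotope0|exact: compact_zonotope].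
have pmin y : zonotope s y -> enorm (x - p) <= enorm (x - y).
  by move=> sy; rewrite -pE; exact: edist_le.
have [z sz zE] := zsupp_attained s (x - p).
have := nearest_point_dotp (@convex_zonotope R n s) sp sz pmin.
have := zsupp_homogeneous_ge H (x - p); rewrite mul1r -zE.
set u := x - p in zE *.
have u0 : 0 < dotp u u.
  rewrite lt_def dotpp_ge0 andbT -enorm_sqr expf_eq0/=; apply/eqP => /enorm_eq0.
  by move=> /eqP; rewrite subr_eq0 => /eqP xp; apply: nsx; rewrite xp.
have := dotp_le_enorm x u.
have xE : p + u = x by rewrite /u addrC subrK.
have -> : dotp x u = dotp p u + dotp u u by rewrite -dotpDl xE.
have eu : 0 <= enorm u by exact: enorm_ge0.
have : enorm x * enorm u <= enorm u by rewrite ler_piMl.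
rewrite dotpDr dotpNr (dotpC u z) (dotpC u p); lra.
Qed.

(** The reflection in the hyperplane orthogonal to w, and the identity for w = 0. Finitely many
    reflections play the part of an average over the orthogonal group; being self-adjoint, they pass
    from the generators of a zonotope to the argument of its support function. *)
Definition householder w x : 'rV[R]_n := x - (2 * dotp x w / dotp w w) *: w.

Lemma householder_sym w x y : dotp (householder w x) y = dotp x (householder w y).
Proof. by rewrite /householder !dotpE (dotpC w y); ring. Qed.

Lemma householderB w x y : householder w (x - y) = householder w x - householder w y.
Proof.
rewrite /householder !dotpE mulrBr mulrBl scalerBl.
by rewrite !opprB -!addrA; congr (_ + _); rewrite addrCA [RHS]addrCA (addrC (- y)).
Qed.

Lemma enorm_householder w x : enorm (householder w x) = enorm x.
Proof.
have [->|w0] := eqVneq w 0; first by rewrite /householder scaler0 subr0.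
have ww : dotp w w != 0.
  by rewrite -enorm_sqr expf_eq0/=; apply: contra w0 => /eqP/enorm_eq0 ->.
apply/eqP; rewrite -(@eqrXn2 _ 2) ?enorm_ge0// !enorm_sqr /householder !dotpE.
by rewrite (dotpC w x); apply/eqP; field.
Qed.

(** For unit vectors 2 x.(x - y) = |x - y|^2, so exactly x - y is subtracted from x. *)
Lemma householder_swap x y : enorm x = 1 -> enorm y = 1 ->
  householder (x - y) x = y.
Proof.
move=> x1 y1; have [->|xy] := eqVneq x y.
  by rewrite /householder subrr scaler0 subr0.
have xx : dotp x x = 1 by rewrite -enorm_sqr x1 expr1n.
have yy : dotp y y = 1 by rewrite -enorm_sqr y1 expr1n.
have w0 : dotp (x - y) (x - y) != 0.
  rewrite -enorm_sqr expf_eq0/=; apply: contra xy => /eqP/enorm_eq0/eqP.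
  by rewrite subr_eq0.
rewrite /householder (_ : _ / _ = 1); first by rewrite scale1r opprB addrC subrK.
apply: (canLR (mulfK w0)); rewrite mul1r !dotpE xx yy (dotpC y x); ring.
Qed.

Lemma zsupp_householder w s u :
  zsupp [seq householder w v | v <- s] u = zsupp s (householder w u).
Proof. by rewrite /zsupp big_map; apply: eq_bigr => v _; rewrite householder_sym. Qed.

Lemma sphere_net c : 0 < c -> exists us : seq 'rV[R]_n,
  (forall u, u \in us -> enorm u = 1) /\
  (forall u, enorm u = 1 -> exists2 v, v \in us & enorm (u - v) < c).
Proof.
move=> c0; pose S := [set u : 'rV[R]_n | enorm u = 1].
have cS : compact S.
  apply: (subclosed_compact _ (@compact_enorm_le R n 1)); last by move=> u /= ->.
  apply: (@closed_comp _ _ (@enorm R n) [set t | t = 1]); last exact: closed_eq.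
  by move=> x _; exact: enorm_continuous.
move: cS; rewrite compact_cover => /(_ _ S (fun v => [set u | enorm (v - u) < c])).
case.
- move=> v _; apply: (@open_comp _ _ (fun u => enorm (v - u)) [set t | t < c]).
    by move=> x _; exact: enorm_dist_continuous.
  exact: open_lt.
- by move=> u Su; exists u => //=; rewrite subrr enorm0.
move=> D' D'S cov; exists (finmap.enum_fset D'); split.
  by move=> u uD; have := D'S u uD; rewrite inE.
by move=> u u1; have [v /= vD vc] := cov u u1; exists v => //; rewrite enormB.
Qed.

(* Averaging the reflected copies of s that carry the points of a net to a point
   w where the support function is small lowers its maximum on the sphere. *)
Lemma zsupp_average s us w c M t : (0 < size us)%N -> enorm w = 1 ->
  (forall u, u \in us -> enorm u = 1) ->
  (forall u, enorm u = 1 -> exists2 v, v \in us & enorm (u - v) < c) ->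
  (forall u, enorm u = 1 -> 1 <= zsupp s u <= M) -> zsupp s w <= t ->
  exists s', forall u, enorm u = 1 ->
    1 <= zsupp s' u <= M + (t + M * c - M) / (size us)%:R.
Proof.
move=> k0 w1 us1 net H tw; set k : R := (size us)%:R.
have kp : 0 < k by rewrite ltr0n.
exists [seq k^-1 *: x | x <- flatten [seq [seq householder (v - w) x | x <- s] | v <- us]].
move=> u u1; rewrite zsupp_scale ?invr_ge0 ?(ltW kp)// zsupp_flatten big_map.
rewrite (eq_bigr (fun v => zsupp s (householder (v - w) u))); last first.
  by move=> v _; rewrite zsupp_householder.
have hE v : enorm (householder (v - w) u) = 1 by rewrite enorm_householder.
have kE c' : \sum_(v <- us) c' = k * c'.
  by rewrite big_const_seq count_predT iter_addr_0 mulr_natl.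
rewrite [k^-1 * _]mulrC ler_pdivlMr// ler_pdivrMr// mulrDl divfK ?gt_eqF//.
apply/andP; split.
  rewrite mul1r -[k]mulr1 -kE; apply: ler_sum => v _.
  by have /andP[] := H _ (hE v).
have [v vus uv] := net u u1; have M1 : 0 <= M.
  by have /andP[h1 h2] := H u u1; rewrite (le_trans _ h2)// (le_trans _ h1).
rewrite (big_rem v)//=.
(* The net point v close to u accounts for t + Mc: its reflection sends v to w, hence u to within c
   of w. Each of the other k - 1 terms is at most M. *)
have -> : M * k + (t + M * c - M) = (t + M * c) + (k - 1) * M by ring.
apply: lerD.
  have -> : householder (v - w) u = w + householder (v - w) (u - v).
    by rewrite householderB (householder_swap (us1 v vus) w1) (addrC w) subrK.
  apply: (le_trans (zsuppD _ _ _)); apply: lerD => //.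
  apply: (le_trans (@zsupp_homogeneous_le s M _ _)).
    by move=> y y1; have /andP[] := H y y1.
  by rewrite enorm_householder ler_wpM2l// ltW.
have -> : k - 1 = (size (rem v us))%:R.
  by rewrite size_rem// -subn1 natrB.
rewrite mulr_natl -[size _]count_predT -iter_addr_0 -big_const_seq.
apply: ler_sum => y _; by have /andP[] := H _ (hE y).
Qed.

(** The segments from 0 to the vectors e_i and -e_i add up to the cube [-1, 1]^n, whose support
    function is the l^1 norm. *)
Lemma zsupp_basis : exists s, forall u, enorm u = 1 -> 1 <= zsupp s u <= n%:R.
Proof.
exists ([seq delta_mx 0 i | i <- index_enum 'I_n] ++ [seq - delta_mx 0 i | i <- index_enum 'I_n]).
move=> u u1.
have dE (i : 'I_n) : dotp (delta_mx 0 i) u = u 0 i.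
  rewrite /dotp (bigD1 i)//= mxE !eqxx mul1r big1 ?addr0// => j ji.
  by rewrite mxE (negbTE ji) andbF mul0r.
have -> : zsupp ([seq delta_mx 0 i | i <- index_enum 'I_n] ++
    [seq - delta_mx 0 i | i <- index_enum 'I_n]) u = \sum_(i < n) `|u 0 i|.
  rewrite /zsupp big_cat /= !big_map -big_split/=; apply: eq_bigr => i _.
  rewrite dotpNl dE; have [i0|i0] := lerP 0 (u 0 i).
    by rewrite max_l ?oppr_le0// addr0 ger0_norm.
  by rewrite max_r ?oppr_ge0 ?ltW// add0r ltr0_norm.
rewrite -{1}u1 enorm_le_sum/=.
rewrite -[n in n%:R]card_ord -sumr_const; apply: ler_sum => i _.
by rewrite -u1 coord_enorm.
Qed.

(** Let m be the infimum of the upper bounds reachable while the lower bound is 1. If m > 1, a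
    nearly optimal zonotope can be improved below m, either by averaging or by shrinking. A unit
    vector is what bounds m below by 1; in dimension 0 there is none and the claim is vacuous. *)
Lemma zsupp_near1 e : 0 < e ->
  exists s, forall u, enorm u = 1 -> 1 <= zsupp s u <= 1 + e.
Proof.
move=> e0; have [[u0 u01]|noS] := pselect (exists u : 'rV[R]_n, enorm u = 1); last first.
  by exists [::] => u u1; exfalso; apply: noS; exists u.
pose E := [set M : R | exists s, forall u, enorm u = 1 -> 1 <= zsupp s u <= M].
have E1 M : E M -> 1 <= M.
  by move=> [s H]; have /andP[] := H u0 u01; exact: le_trans.
have E0 : has_inf E.
  split; last by exists 1 => M; exact: E1.
  by have [s H] := zsupp_basis; exists n%:R, s.
set m := inf E; have m1 : 1 <= m by apply: lb_le_inf; [exact: E0.1|exact: E1].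
have [mlt|mgt] := ltP m (1 + e).
  have [M [s H] Me] := inf_lt E0.1 mlt.
  exists s => u u1; have /andP[h1 h2] := H u u1.
  by rewrite h1 (le_trans h2)// ltW.
exfalso.
have mp : 0 < m - 1 by lra.
(* With M <= m + 1 this gives Mc <= (m - 1)/4, while M - t >= (m - 1)/2 for the t below. Averaging
   over k net points thus gains at least (m - 1)/(4k), and [h] is chosen so that M exceeds m by less
   than that. *)
pose c := (m - 1) / (4 * (m + 1)).
have c0 : 0 < c by rewrite divr_gt0//; lra.
have [us [us1 net]] := sphere_net c0.
have [v0 v0us _] := net u0 u01.
have k0 : (0 < size us)%N by case: (us) v0us.
pose k : R := (size us)%:R.
have k1 : 1 <= k by rewrite ler1n.
have kp : 0 < k by lra.
pose h := Num.min 1 ((m - 1) / (4 * k)).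
have h0 : 0 < h by rewrite lt_min ltr01 divr_gt0//; lra.
have h1 : h <= 1 by rewrite ge_min lexx.
have hk : h * (4 * k) <= m - 1.
  by rewrite -ler_pdivlMr ?ge_min ?lexx ?orbT//; lra.
have mh : m < m + h by rewrite ltrDl.
have [M [s H] Mm] := inf_lt E0.1 mh.
have mM : m <= M by apply: ge_inf; [exact: E0.2|exists s].
have inf_contra B : E B -> B < m -> False.
  by move=> EB Bm; have := ge_inf E0.2 EB; rewrite leNgt Bm.
pose t := (1 + m) / 2.
(* Either the support function falls to t, the midpoint of 1 and m, somewhere on the sphere, and
   averaging lowers the maximum; or it stays above t, and dividing by t brings the maximum below
   m. *)
have [[w [w1 wt]]|noW] := pselect (exists w, enorm w = 1 /\ zsupp s w <= t).
  have [s' H'] := zsupp_average k0 w1 us1 net H wt.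
  apply: (inf_contra _ (ex_intro _ s' H')); rewrite -/k.
  rewrite -ltrBrDl ltr_pdivrMr//.
  have Mc : M * c <= (m - 1) / 4.
    rewrite /c mulrA ler_pdivrMr; last by lra.
    by rewrite mulrAC; nra.
  by rewrite /t; nra.
have t0 : 0 < t by rewrite /t; lra.
apply: (inf_contra (M / t)); last by rewrite ltr_pdivrMr// /t; nra.
exists [seq t^-1 *: x | x <- s] => u u1; rewrite zsupp_scale ?invr_ge0 ?(ltW t0)//.
rewrite mulrC ler_pdivlMr// mul1r ler_pM2r ?invr_gt0//.
have /andP[_ ->] := H u u1; rewrite andbT leNgt; apply/negP => ut.
by apply: noW; exists u; split => //; exact: ltW.
Qed.

Lemma zonotope_ball e : 0 < e -> exists s,
  @eball R n `<=` zonotope s /\ zonotope s `<=` dilate (1 + e) (@eball R n).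
Proof.
move=> e0; have [s H] := zsupp_near1 e0; exists s; split.
  by apply: ball_subset_zonotope => u u1; have /andP[] := H u u1.
apply: zonotope_subset_ball; first lra.
by move=> u u1; have /andP[] := H u u1.
Qed.

End support_function.
(** * Steiner's formula *)

Lemma expr1D_le (R : realType) n (e : R) : 0 <= e <= 1 ->
  (1 + e) ^+ n <= 1 + e * 2 ^+ n.
Proof.
move=> /andP[e0 e1].
(* The chord of the convex function (1 + e)^n over [0, 1]; this sharper slope is the one that passes
   through the induction. *)
suff : (1 + e) ^+ n <= 1 + e * (2 ^+ n - 1) by nra.
elim: n => [|n IH]; first by rewrite !expr0 subrr mulr0 addr0.
rewrite !exprS; have p1 : 1 <= 2 ^+ n :> R by rewrite exprn_ege1// ler1n.
apply: (@le_trans _ _ ((1 + e) * (1 + e * (2 ^+ n - 1)))).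
  by apply: ler_wpM2l => //; rewrite addr_ge0.
have : 0 <= (1 - e) * e * (2 ^+ n - 1) by rewrite !mulr_ge0 ?subr_ge0.
nra.
Qed.

Lemma poly_interpolation (R : realType) n : exists l : 'I_n.+1 -> {poly R},
  (forall i, (size (l i) <= n.+1)%N) /\
  forall p : {poly R}, (size p <= n.+1)%N ->
    p = \sum_(i < n.+1) p.[i%:R]%:P * l i.
Proof.
pose x (i : nat) : R := i%:R.
have x_inj : injective x by move=> i j /eqP; rewrite eqr_nat => /eqP.
exists (fun i => tnth (lagrange n.+1 x) i); split; last by move=> p; exact: lagrange_gen.
by move=> i; rewrite size_lagrange_.
Qed.

Section steiner_formula.
Variables (R : realType) (n : nat).
Implicit Types K : set 'rV[R]_n.

Lemma eball0 : @eball R n 0.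
Proof. by rewrite /eball/= enorm0. Qed.

Lemma compact_add_ball K r : compact K ->
  compact (minkowski_add K (dilate r (@eball R n))).
Proof.
move=> cK; apply: compact_minkowski_add => //.
by apply: compact_dilate; exact: compact_eball.
Qed.

(** A zonotope between B and (1 + e)B squeezes the volume within a factor (1 + e)^n, so the error is
    relative to F and holds for all r with one polynomial. *)
Lemma rvol_add_ball_near_poly K e : compact K -> convex_set K -> K 0 ->
  0 < e <= 1 -> exists p : {poly R}, (size p <= n.+1)%N /\
  forall r, 0 <= r -> let F := rvol (minkowski_add K (dilate r (@eball R n))) in
    `|F - p.[r]| <= e * (2 ^+ n * F).
Proof.
move=> cK xK K0 /andP[e0 e1].
have [s [Bs sB]] := @zonotope_ball R n e e0.
have cs := @compact_zonotope R n s; have xs := @convex_zonotope R n s.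
have cKs r : compact (minkowski_add K (dilate r (zonotope s))).
  by apply: compact_minkowski_add => //; exact: compact_dilate.
have [p pE] := rvol_add_zonotope s cK xK; exists p; split.
  apply: (@size_poly_growth _ _ _ (rvol (minkowski_add K (zonotope s)))) => r r0.
  rewrite -pE// rvol_ge0/= mulrC.
  by apply: rvol_add_growth => //; exact: zonotope0.
move=> r r0 /=; set F := rvol _; rewrite -pE//.
have l : F <= rvol (minkowski_add K (dilate r (zonotope s))).
  by apply: le_rvol => //; [exact: compact_add_ball|apply: minkowski_addS => //; exact: dilateS].
have u : rvol (minkowski_add K (dilate r (zonotope s))) <= (1 + e * 2 ^+ n) * F.
  apply: (@le_trans _ _ ((1 + e) ^+ n * F)); last first.
    by apply: ler_wpM2r; [exact: rvol_ge0|apply: expr1D_le; rewrite (ltW e0)].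
  apply: (@le_trans _ _ (rvol (minkowski_add K (dilate ((1 + e) * r) (@eball R n))))).
    apply: le_rvol => //; first exact: compact_add_ball.
    apply: minkowski_addS => // x [y /sB[z Bz <-] <-]; exists z => //.
    by rewrite scalerA mulrC.
  apply: rvol_add_dilate_le => //; first exact: compact_eball.
  - exact: convex_eball.
  - exact: eball0.
  - by rewrite lerDl ltW.
by rewrite distrC ger0_norm ?subr_ge0//; move: u; rewrite mulrDl mul1r -mulrA; lra.
Qed.

(** The candidate interpolates F at 0, ..., n. Each approximating polynomial is its own interpolant,
    so its distance to the candidate at r is controlled by its errors at the nodes; the resulting
    constant [C] depends on r but not on e, which then tends to 0. *)
Lemma rvol_add_ball_poly K : compact K -> convex_set K -> K 0 ->
  exists p : {poly R}, (size p <= n.+1)%N /\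
  forall r, 0 <= r -> rvol (minkowski_add K (dilate r (@eball R n))) = p.[r].
Proof.
move=> cK xK K0; pose F r := rvol (minkowski_add K (dilate r (@eball R n))).
have [l [ls lE]] := poly_interpolation R n.
pose P := \sum_(i < n.+1) (F i%:R)%:P * l i; exists P; split.
  rewrite /P; apply: (leq_trans (size_sum _ _ _)); apply/bigmax_leqP => i _.
  apply: leq_trans (ls i).
  by rewrite mul_polyC size_scale_leq.
move=> r r0; rewrite -/(F r).
pose C := 2 ^+ n * F r + \sum_(i < n.+1) 2 ^+ n * F i%:R * `|(l i).[r]|.
have F0 t : 0 <= F t by exact: rvol_ge0.
have C0 : 0 <= C.
  rewrite addr_ge0 ?mulr_ge0 ?exprn_ge0//.
  by apply: sumr_ge0 => i _; rewrite !mulr_ge0 ?exprn_ge0.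
have key e : 0 < e <= 1 -> `|F r - P.[r]| <= e * C.
  move=> e01; have [p [sp pF]] := rvol_add_ball_near_poly cK xK K0 e01.
  have pP : `|p.[r] - P.[r]| <= e * \sum_(i < n.+1) 2 ^+ n * F i%:R * `|(l i).[r]|.
    rewrite {1}(lE p sp) /P !horner_sum -sumrB mulr_sumr.
    apply: (le_trans (ler_norm_sum _ _ _)); apply: ler_sum => i _.
    rewrite !hornerM !hornerC -mulrBl normrM mulrA; apply: ler_wpM2r => //.
    by rewrite distrC; exact: pF.
  have -> : F r - P.[r] = (F r - p.[r]) + (p.[r] - P.[r]) by rewrite addrA subrK.
  apply: (le_trans (ler_normD _ _)); rewrite /C mulrDr; apply: lerD => //.
  exact: pF.
apply/eqP; rewrite -subr_eq0 -normr_le0 leNgt; apply/negP => d0.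
have := key (Num.min 1 (`|F r - P.[r]| / (2 * (C + 1)))).
rewrite lt_min ltr01/= divr_gt0 ?mulr_gt0 ?ltr_wpDl// ge_min lexx/= => /(_ isT).
rewrite leNgt => /negP; apply.
apply: (@le_lt_trans _ _ (`|F r - P.[r]| / (2 * (C + 1)) * C)).
  by apply: ler_wpM2r => //; rewrite ge_min lexx orbT.
rewrite mulrAC ltr_pdivrMr; last lra.
by rewrite ltr_pM2l//; lra.
Qed.

Lemma steiner_sum (V : 'I_n.+1 -> R) (r : R) :
  \sum_(i < n.+1) kappa R (n - i) * V i * r ^+ (n - i) =
  (\poly_(i < n.+1) (kappa R i * V (rev_ord (inord i)))).[r].
Proof.
rewrite horner_poly (reindex_inj rev_ord_inj)/=; apply: eq_bigr => i _.
have -> : (n - (n.+1 - i.+1))%N = i by rewrite subSS subKn// -ltnS.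
by rewrite inord_val.
Qed.

Lemma steiner_exists K : convex_body K -> exists V, steiner K V.
Proof.
move=> [[k Kk] cK xK].
(* The growth bounds ask for 0 in the body; translating K by -k leaves the volumes of its parallel
   bodies unchanged. *)
pose K' := minkowski_add K [set - k].
have cK' : compact K' by apply: compact_minkowski_add => //; exact: compact_set1.
have xK' : convex_set K'.
  apply: convex_minkowski_add => //; apply/convex_setP => x y t _ /= -> ->.
  by rewrite -scalerDl addrC subrK scale1r.
have K'0 : K' 0 by exists k => //; exists (- k) => //; rewrite subrr.
have [p [sp pE]] := rvol_add_ball_poly cK' xK' K'0.
exists (fun i => p`_(n - i) / kappa R (n - i)) => r r0.
have cKr := compact_add_ball (r := r) cK.
rewrite rvolE//; congr EFin.
transitivity p.[r]; last first.
  rewrite steiner_sum (horner_coef_wide _ sp) horner_poly; apply: eq_bigr => i _.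
  congr (_ * _); rewrite /= inordK ?ltn_ord// subSS subKn; last by rewrite -ltnS.
  by rewrite mulrCA divff ?mulr1// gt_eqF// kappa_gt0.
rewrite -pE// -(rvol_translate (- k) cKr); congr rvol.
rewrite /K' -minkowski_addA (minkowski_addC [set _]) minkowski_addA.
apply/seteqP; split => x; first by move=> [y Ky <-]; exists y => //; exists (- k).
by move=> [y Ky [_ -> <-]]; exists y.
Qed.

Lemma poly_eq_nonneg (p q : {poly R}) :
  (forall r, 0 <= r -> p.[r] = q.[r]) -> p = q.
Proof.
move=> pq; apply/eqP; rewrite -subr_eq0; apply/eqP.
apply: (@roots_geq_poly_eq0 _ _ [seq i%:R | i <- iota 0 (size (p - q))]).
- apply/allP => _ /mapP[i _ ->]; rewrite /root hornerE hornerN pq ?subrr//.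
- rewrite map_inj_uniq ?iota_uniq// => i j /eqP; rewrite eqr_nat => /eqP //.
- by rewrite size_map size_iota.
Qed.

Lemma steiner_unique K V V' : steiner K V -> steiner K V' -> V = V'.
Proof.
move=> S S'; apply/funext => i.
have E : \poly_(i < n.+1) (kappa R i * V (rev_ord (inord i))) =
         \poly_(i < n.+1) (kappa R i * V' (rev_ord (inord i))).
  apply: poly_eq_nonneg => r r0; rewrite -!steiner_sum; apply: EFin_inj.
  by rewrite -S// -S'.
have := congr1 (fun p : {poly R} => p`_(rev_ord i)) E.
rewrite !coef_poly ltn_ord inord_val rev_ordK => /mulfI; apply.
by rewrite gt_eqF// kappa_gt0.
Qed.

(** Whatever solution [xget] returns, uniqueness identifies it with the one at hand. *)
Lemma wills_steiner K V : steiner K V -> wills K = \sum_(i < n.+1) V i.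
Proof.
move=> S; rewrite /wills /intrinsic_volume; apply: eq_bigr => i _.
congr (_ i); apply: (steiner_unique _ S).
by have := @xgetPex _ (fun=> 0) [set V | steiner K V] (ex_intro _ V S).
Qed.

Lemma wills_set0 : wills (set0 : set 'rV[R]_n) = 0.
Proof.
rewrite (@wills_steiner _ (fun=> 0)) ?big1// => r r0.
rewrite (_ : minkowski_add _ _ = set0) ?measure0; last first.
  by rewrite -subset0 => x [].
by rewrite big1// => i _; rewrite mulr0 mul0r.
Qed.

End steiner_formula.
(** * The Gaussian integral formula *)

Section gaussian_radial.
Variable R : realType.
Implicit Types (r a : R).

Definition rgauss r : R := expR (- (pi * r ^+ 2)).

(* Minus the derivative of [rgauss]: its integral over [d, +oo[ is [rgauss d]. *)
Definition rdens r : R := 2 * pi * r * rgauss r.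

Lemma rgauss_ge0 r : 0 <= rgauss r. Proof. exact: expR_ge0. Qed.

Lemma rdens_ge0 r : 0 <= r -> 0 <= rdens r.
Proof. by move=> r0; rewrite !mulr_ge0 ?rgauss_ge0// pi_ge0. Qed.

Lemma is_derive_rgauss r : is_derive r (1 : R) (fun x => - rgauss x) (rdens r).
Proof.
rewrite /rgauss.
apply: is_derive_eq.
by rewrite /rdens /rgauss /GRing.scale/= !mulr1; ring.
Qed.

Lemma rgauss_cvg0 : rgauss x @[x --> +oo%R] --> (0 : R).
Proof.
apply: (@squeeze_cvgr _ _ _ _ (fun=> 0) (@gauss_fun R)).
- near=> x; rewrite rgauss_ge0/= ler_expR lerN2 ler_peMl ?sqr_ge0//.
  by have := pi_ge2 R; lra.
- exact: cvg_cst.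
- exact: cvg_gauss_fun.
Unshelve. all: by end_near. Qed.

Lemma continuous_rgauss : continuous rgauss.
Proof.
move=> x; rewrite /rgauss.
apply: (@continuous_comp _ _ _ (fun x : R => - (pi * x ^+ 2)) expR); last exact: continuous_expR.
apply: continuousN; apply: continuousM; first exact: cvg_cst.
exact: exprn_continuous.
Qed.

Lemma continuous_rdens : continuous rdens.
Proof.
move=> x; apply: continuousM; last exact: continuous_rgauss.
apply: continuousM; first exact: cvg_cst.
exact: cvg_id.
Qed.

Lemma measurable_rgauss : measurable_fun setT rgauss.
Proof. by apply: continuous_measurable_fun; exact: continuous_rgauss. Qed.

Lemma measurable_rdens : measurable_fun setT rdens.
Proof. by apply: continuous_measurable_fun; exact: continuous_rdens. Qed.

Local Open Scope ereal_scope.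

Lemma integral_rdens (d : R) : (0 <= d)%R ->
  \int[@lebesgue_measure R]_(r in `[d, +oo[) (rdens r)%:E = (rgauss d)%:E.
Proof.
move=> d0; rewrite (@ge0_continuous_FTC2y _ rdens (fun x => - rgauss x)%R d 0%R).
- by rewrite sub0e -EFinN opprK.
- by move=> x dx; apply: rdens_ge0; exact: le_trans dx.
- by apply: continuous_subspaceT; exact: continuous_rdens.
- by rewrite -oppr0; apply: cvgN; exact: rgauss_cvg0.
- by move=> x _; have [] := is_derive_rgauss x.
- apply: cvg_at_right_filter; apply: continuousN; exact: continuous_rgauss.
- by move=> x _; rewrite derive1E; have [_ ->] := is_derive_rgauss x.
Qed.

(** By [integral_rdens], the integrand at x is the integral of [rdens] over r >= f x; Tonelli
    exchanges r and x. *)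
Lemma layer_cake d (T : measurableType d)
    (mu : {sigma_finite_measure set T -> \bar R}) (f : T -> R) :
  measurable_fun setT f -> (forall x, (0 <= f x)%R) ->
  \int[mu]_x (rgauss (f x))%:E =
  \int[@lebesgue_measure R]_(r in `[0%R, +oo[) ((rdens r)%:E * mu [set x | (f x <= r)%R]).
Proof.
move=> mf f0.
pose D : set (T * measurableTypeR R) := [set p | (f p.1 <= p.2)%R].
(* [rdens] is negative for r < 0, where the indicator vanishes because f >= 0; the maximum with 0
   makes [h] visibly nonnegative everywhere, as Tonelli asks. *)
pose h (p : T * measurableTypeR R) : \bar R := (Num.max 0 (rdens p.2) * \1_D p)%:E.
have mD : measurable D.
  have -> : D = (fun p : T * measurableTypeR R => (p.2 : R) - f p.1)%R @^-1` `[0%R, +oo[%classic.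
    by apply/seteqP; split => p; rewrite /D/= in_itv/= andbT subr_ge0.
  rewrite -[X in measurable X]setTI.
  have : measurable_fun setT (fun p : T * measurableTypeR R => (p.2 : R) - f p.1)%R.
    apply: measurable_funB; first exact: measurable_snd.
    by apply: measurableT_comp => //; exact: measurable_fst.
  by apply => //; exact: measurable_itv.
have DE x r : \1_D (x, r) = (f x <= r)%R%:R :> R.
  by rewrite indicE; congr ((nat_of_bool _)%:R); apply/idP/idP => [/set_mem//|H]; exact/mem_set.
have mh : measurable_fun setT h.
  apply/measurable_EFinP; apply: measurable_funM; last exact: measurable_indic.
  apply: measurable_maxr; first exact: measurable_cst.
  exact: (measurableT_comp measurable_rdens (@measurable_snd _ _ T (measurableTypeR R))).
have h0 p : 0 <= h p by rewrite lee_fin mulr_ge0// le_max lexx.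
transitivity (\int[mu]_x \int[@lebesgue_measure R]_r h (x, r)).
  apply: eq_integral => x _; rewrite -integral_rdens//.
  rewrite [LHS]integral_mkcond; apply: eq_integral => r _.
  rewrite patchE /h DE/=.
  have -> : (r \in `[f x, +oo[%classic) = (f x <= r)%R.
    by apply/idP/idP; rewrite inE/= in_itv/= andbT.
  case: ifPn => xr; last by rewrite mulr0.
  by rewrite mulr1 max_r// rdens_ge0// (le_trans _ xr).
rewrite (fubini_tonelli _ mh h0).
rewrite [RHS]integral_mkcond; apply: eq_integral => r _; rewrite patchE.
have [r0|r0] := boolP (r \in _).
  move: r0; rewrite inE/= in_itv/= andbT => r0.
  have mA : measurable [set x | (f x <= r)%R].
    rewrite -[X in measurable X]setTI.
    rewrite (_ : mkset _ = f @^-1` `]-oo, r]%classic); last first.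
      by apply/seteqP; split => x /=; rewrite in_itv.
    by apply: mf => //; exact: measurable_itv.
  rewrite (eq_integral (fun x => (rdens r)%:E * (\1_[set x | (f x <= r)%R] x)%:E)); last first.
    move=> x _; rewrite /h DE/= max_r ?rdens_ge0// EFinM indicE.
    by congr (_ * ((nat_of_bool _)%:R)%:E); apply/idP/idP => [H|/set_mem//]; exact/mem_set.
  rewrite ge0_integralZl//.
  - by rewrite integral_indic// setIT.
  - exact/measurable_EFinP/measurable_indic.
  - by rewrite lee_fin rdens_ge0.
rewrite integral0_eq// => x _; rewrite /h DE/=.
case: leP => [xr|]; last by rewrite mulr0.
by move/negP: r0; case; rewrite inE/= in_itv/= andbT (le_trans (f0 x)).
Qed.

(** Rescaling by sqrt(pi) the integral of exp(-t^2); the factor pi in the exponent makes the total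
    mass 1, in every dimension. *)
Lemma integral_rgauss1 : \int[@lebesgue_measure R]_t (rgauss t)%:E = 1.
Proof.
have pi0 := pi_gt0 R.
have sp : (0 < Num.sqrt pi :> R)%R by rewrite sqrtr_gt0.
have := @ge0_integral_affine R (Num.sqrt pi) 0%R (fun x => (gauss_fun x)%:E) sp.
rewrite integralT_gauss => H.
transitivity (\int[@lebesgue_measure R]_t (gauss_fun (Num.sqrt pi * t + 0)%R)%:E).
  apply: eq_integral => t _; rewrite addr0 /gauss_fun /rgauss exprMn sqr_sqrtr//.
  exact: ltW.
rewrite -[LHS]mul1e -(@mulVf _ (Num.sqrt pi : R)) ?gt_eqF// EFinM -muleA -H.
- by rewrite -EFinM mulVf// gt_eqF.
- have mg : measurable_fun setT (fun x : R => (gauss_fun x)%:E).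
    apply/measurable_EFinP.
    exact: measurable_gauss_fun.
  exact: mg.
- by move=> t; rewrite lee_fin gauss_fun_ge0.
Qed.

Lemma measurable_enorm n : measurable_fun setT (@enorm R n).
Proof.
apply: (measurability _ (RGenOpens.measurableE R)) => _ [_ [a [b ->]] <-].
rewrite setTI; apply: open_measurable_rV; apply: open_comp; last exact: itv_open.
by move=> x _; exact: enorm_continuous.
Qed.

Lemma integral_rgauss_enorm n : \int[@vol R n]_x (rgauss (enorm x))%:E = 1.
Proof.
have mr m : measurable_fun setT (fun x : 'rV[R]_m => (rgauss (enorm x))%:E).
  apply/measurable_EFinP; apply: (measurableT_comp measurable_rgauss).
  exact: measurable_enorm.
elim: n => [|n IH].
  rewrite (_ : (fun x => _) = cst 1); last first.
    by apply/funext => x; rewrite /rgauss enorm_sqr /dotp big_ord0 mulr0 oppr0 expR0.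
  rewrite integral_cst// mul1e /= indicE; congr EFin.
  by rewrite mem_set.
rewrite ge0_integral_volS//; last by move=> x; rewrite lee_fin rgauss_ge0.
rewrite -[RHS]integral_rgauss1; apply: eq_integral => t _.
rewrite (eq_integral (fun y => (rgauss t)%:E * (rgauss (enorm y))%:E)); last first.
  move=> y _; rewrite -EFinM /rgauss -expRD !enorm_sqr; congr (expR _)%:E.
  rewrite -opprD -mulrDr; congr (- (_ * _))%R.
  rewrite /dotp big_ord_recl rV_cons0 expr2; congr (_ + _)%R.
  by apply: eq_bigr => i _; rewrite rV_consS.
rewrite ge0_integralZl//.
- by rewrite IH mule1.
- exact: mr.
- by move=> y _; rewrite lee_fin rgauss_ge0.
- by rewrite lee_fin rgauss_ge0.
Qed.

(** The layer cake formula for the Euclidean norm reads 1 = kappa_n times this moment, since the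
    ball of radius r has volume kappa_n r^n. *)
Lemma integral_rdens_moment (n : nat) :
  \int[@lebesgue_measure R]_(r in `[0%R, +oo[) (rdens r * r ^+ n)%:E =
  ((kappa R n)^-1)%:E.
Proof.
have k0 := kappa_gt0 R n.
have rk : rvol (@eball R n) = kappa R n by [].
have E : \int[@lebesgue_measure R]_(r in `[0%R, +oo[)
    ((kappa R n)%:E * (rdens r * r ^+ n)%:E) = 1.
  rewrite -(integral_rgauss_enorm n).
  rewrite (layer_cake (@vol R n) (@measurable_enorm n) (@enorm_ge0 R n)).
  apply: eq_integral => r; rewrite inE/= in_itv/= andbT => r0.
  (* The scaling law for volumes is for positive factors; at r = 0 the density vanishes. *)
  have [->|rn0] := eqVneq r 0%R.
    by rewrite /rdens mulr0 !mul0r mule0 mul0e.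
  rewrite -dilate_eballE// rvolE; last by apply: compact_dilate; exact: compact_eball.
  rewrite rvol_dilate; [|by rewrite lt_def rn0|exact: compact_eball].
  by rewrite rk -!EFinM mulrC -mulrA.
have m0 (r : R) : `[0%R, +oo[%classic r -> 0 <= (rdens r * r ^+ n)%:E.
  by rewrite /= in_itv/= andbT => r0; rewrite lee_fin mulr_ge0 ?rdens_ge0 ?exprn_ge0.
have mm : measurable_fun (`[0%R, +oo[ : set R) (fun r => (rdens r * r ^+ n)%:E).
  apply: measurable_funTS; apply/measurable_EFinP.
  by apply: measurable_funM; [exact: measurable_rdens|exact: measurable_funX].
move: E; rewrite ge0_integralZl//; last by rewrite lee_fin ltW.
move=> H; rewrite -[LHS]mul1e -(@mulVf _ (kappa R n)) ?gt_eqF// EFinM -muleA H.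
by rewrite mule1.
Qed.

(** The coefficients of a Steiner polynomial come without a sign, so linearity of the integral in
    [wills_integral] rests on integrability instead of nonnegativity. *)
Lemma integrable_rdens_moment (n : nat) :
  (@lebesgue_measure R).-integrable `[0%R, +oo[ (fun r => (rdens r * r ^+ n)%:E).
Proof.
have mm : measurable_fun (`[0%R, +oo[ : set R) (fun r => (rdens r * r ^+ n)%:E).
  apply: measurable_funTS; apply/measurable_EFinP.
  by apply: measurable_funM; [exact: measurable_rdens|exact: measurable_funX].
apply/integrableP; split => //.
rewrite [ltLHS](_ : _ = ((kappa R n)^-1)%:E) ?ltry//.
rewrite -integral_rdens_moment; apply: eq_integral => r.
rewrite inE/= in_itv/= andbT => r0.
by rewrite ger0_norm// mulr_ge0 ?rdens_ge0 ?exprn_ge0.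
Qed.

(** Integrating the Steiner polynomial against [rdens] turns each r^(n-i) into the inverse of
    kappa_(n-i), which cancels the constant in front of V_i. *)
Lemma wills_integral n (K : set 'rV[R]_n) : convex_body K ->
  \int[@vol R n]_x (rgauss (edist K x))%:E = (wills K)%:E.
Proof.
move=> xK; have [V SV] := steiner_exists xK; have [K0 cK _] := xK.
rewrite (wills_steiner SV).
rewrite (layer_cake (@vol R n) (measurable_edist K0 cK) (@edist_ge0 R n K)).
transitivity (\int[@lebesgue_measure R]_(r in `[0%R, +oo[)
    \sum_(i < n.+1) (kappa R (n - i) * V i)%:E * (rdens r * r ^+ (n - i))%:E).
  apply: eq_integral.
  move=> r; rewrite inE/= in_itv/= andbT => r0.
  rewrite -minkowski_add_ballE// SV// -EFinM mulr_sumr -sumEFin.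
  by apply: eq_bigr => i _; rewrite -EFinM mulrCA.
rewrite integral_sum//; last by move=> i; apply: integrableZl => //; exact: integrable_rdens_moment.
rewrite -sumEFin; apply: eq_bigr => i _.
rewrite integralZl//; last exact: integrable_rdens_moment.
rewrite integral_rdens_moment -EFinM mulrAC divff ?mul1r//.
by rewrite gt_eqF// kappa_gt0.
Qed.

End gaussian_radial.

(** * The product inequality *)

Section wills_product.
Variables (R : realType) (n : nat).
Implicit Types (K L : set 'rV[R]_n).

Lemma wills_ge0 K : convex_body K -> 0 <= wills K.
Proof.
move=> cK; rewrite -lee_fin -wills_integral//.
by apply: integral_ge0 => x _; rewrite lee_fin rgauss_ge0.
Qed.

Lemma convex_body_dilate c K : convex_body K -> convex_body (dilate c K).
Proof.
move=> [[k Kk] cK xK]; split; [|exact: compact_dilate|exact: convex_dilate].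
by exists (c *: k); exists k.
Qed.

Lemma convex_body_minkowski_sub K L : convex_body K -> convex_body L ->
  convex_body (minkowski_sub K L).
Proof.
move=> [[k Kk] cK xK] [[l Ll] cL xL].
split; [|exact: compact_minkowski_sub|exact: convex_minkowski_sub].
by exists (k - l); exists k => //; exists l.
Qed.

Lemma convex_midpoint K x y : convex_set K -> K x -> K y -> K (2^-1 *: (x + y)).
Proof.
move=> /convex_setP xK Kx Ky; have := xK x y 2^-1 _ Kx Ky.
rewrite scalerDr (_ : 1 - 2^-1 = 2^-1 :> R); last by field.
by apply; apply/andP; split; lra.
Qed.

Lemma parallelogram (x y : 'rV[R]_n) :
  dotp (x + y) (x + y) + dotp (x - y) (x - y) = 2 * dotp x x + 2 * dotp y y.
Proof. by rewrite !dotpE (dotpC y x); ring. Qed.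

(** The quantifiers matter: b depends on w but not on a, so at fixed w the map a -> a/2 + b is a
    homothety and can serve as a change of variables. *)
Lemma edist_midpoint K L w : convex_body K -> convex_body L ->
  K `&` L !=set0 -> exists b : 'rV[R]_n, forall a,
  edist K (w + (2^-1 *: a + b)) ^+ 2 + edist L (2^-1 *: a + b) ^+ 2 <=
  edist (K `&` L) a ^+ 2 + edist (dilate 2^-1 (minkowski_sub K L)) w ^+ 2.
Proof.
move=> bK bL KL0; have [K0 cK xK] := bK; have [L0 cL xL] := bL.
have [M0 cM _] := convex_body_dilate 2^-1 (convex_body_minkowski_sub bK bL).
have [_ [_ [k Kk [l Ll <-]] <-] pE] := edist_attained w M0 cM.
exists (2^-1 *: (2^-1 *: (k + l)) - 2^-1 *: w) => a.
have [q [Kq Lq] qE] := edist_attained a KL0 (compact_setI_rV cK cL).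
rewrite pE qE; set r := w - _; set s := a - q.
pose y := 2^-1 *: a + (2^-1 *: (2^-1 *: (k + l)) - 2^-1 *: w).
(* Here r is the error of w against (k - l)/2 and s that of a against q. The two midpoints lie in L
   and K, so these vectors dominate the distances of y to L and of w + y to K. *)
have yE : y - 2^-1 *: (q + l) = 2^-1 *: s - 2^-1 *: r.
  by apply/rowP => i; rewrite /y /s /r !mxE; field.
have xE : w + y - 2^-1 *: (q + k) = 2^-1 *: s + 2^-1 *: r.
  by apply/rowP => i; rewrite /y /s /r !mxE; field.
have dK := edist_le (w + y) (convex_midpoint xK Kq Kk).
have dL := edist_le y (convex_midpoint xL Lq Ll).
move: dK dL; rewrite yE xE -/y => dK dL.
apply: (@le_trans _ _ (enorm (2^-1 *: s + 2^-1 *: r) ^+ 2 +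
    enorm (2^-1 *: s - 2^-1 *: r) ^+ 2)).
  by apply: lerD; apply: lerXn2r; rewrite ?nnegrE ?edist_ge0 ?enorm_ge0.
rewrite !enorm_sqr parallelogram.
have := dotpp_ge0 s; have := dotpp_ge0 r; move: (s) (r) => u v v0 u0.
rewrite !dotpZl !dotpZr; move: (dotp u u) (dotp v v) u0 v0; clear => b c; lra.
Qed.

Local Open Scope ereal_scope.

Lemma measurable_rgauss_edist K : convex_body K ->
  measurable_fun setT (fun x => (rgauss (edist K x))%:E).
Proof.
move=> [K0 cK _]; apply/measurable_EFinP.
by apply: (measurableT_comp (@measurable_rgauss R)); exact: measurable_edist.
Qed.

Lemma wills_integralZ K (c : R) : convex_body K -> (0 <= c)%R ->
  \int[@vol R n]_x (c * rgauss (edist K x))%:E = (c * wills K)%:E.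
Proof.
move=> bK c0; under eq_integral do rewrite EFinM.
rewrite ge0_integralZl//; first by rewrite wills_integral.
- exact: measurable_rgauss_edist.
- by move=> x _; rewrite lee_fin rgauss_ge0.
Qed.

Lemma measurable_rV_add d (T : measurableType d) (f g : T -> 'rV[R]_n) :
  measurable_fun setT f -> measurable_fun setT g ->
  measurable_fun setT (fun x => (f x + g x)%R).
Proof.
move=> mf mg; apply: measurable_fun_rVP => i; under eq_fun do rewrite mxE.
apply: measurable_funD.
  exact: (measurableT_comp (@measurable_rV_coord R n i) mf).
exact: (measurableT_comp (@measurable_rV_coord R n i) mg).
Qed.

Lemma ge0_integral_vol_translate (b : 'rV[R]_n) (f : 'rV[R]_n -> \bar R) :
  measurable_fun setT f -> (forall x, 0 <= f x) ->
  \int[@vol R n]_x f x = \int[@vol R n]_x f (x + b)%R.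
Proof.
move=> mf f0; rewrite (ge0_integral_vol_affine b ltr01 mf f0) expr1n mul1e.
by apply: eq_integral => x _; rewrite scale1r.
Qed.

(** The translation x = w + y at fixed y, followed by Tonelli, makes the difference w = x - y the
    outer variable, to be compared with (K - L)/2. *)
Lemma wills_mulE K L : convex_body K -> convex_body L ->
  (wills K * wills L)%:E = \int[@vol R n]_w \int[@vol R n]_y
    (rgauss (edist K (w + y)%R) * rgauss (edist L y))%:E.
Proof.
move=> bK bL.
pose G (p : 'rV[R]_n * 'rV[R]_n) : \bar R :=
  (rgauss (edist K (p.1 + p.2)%R) * rgauss (edist L p.2))%:E.
have mG : measurable_fun setT G.
  apply/measurable_EFinP; apply: measurable_funM.
    apply/measurable_EFinP; apply: (measurableT_comp (measurable_rgauss_edist bK)).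
    by apply: measurable_rV_add.
  by apply/measurable_EFinP; apply: (measurableT_comp (measurable_rgauss_edist bL)).
have G0 p : 0 <= G p by rewrite lee_fin mulr_ge0 ?rgauss_ge0.
rewrite (fubini_tonelli G mG G0).
rewrite EFinM -(wills_integral bL) -ge0_integralZl//; last 3 first.
- exact: measurable_rgauss_edist.
- by move=> y _; rewrite lee_fin rgauss_ge0.
- by rewrite lee_fin wills_ge0.
apply: eq_integral => y _.
have K0 x : 0 <= (rgauss (edist K x))%:E by rewrite lee_fin rgauss_ge0.
rewrite -(wills_integral bK).
rewrite (ge0_integral_vol_translate y (measurable_rgauss_edist bK) K0).
have mF : measurable_fun setT
    (fun x : 'rV[R]_n => (rgauss (edist K (x + y)%R))%:E).
  apply: (measurableT_comp (measurable_rgauss_edist bK)).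
  exact: measurable_rV_add.
have F0 (x : 'rV[R]_n) : setT x -> 0 <= (rgauss (edist K (x + y)%R))%:E.
  by move=> _; rewrite lee_fin rgauss_ge0.
have L0 : 0 <= (rgauss (edist L y))%:E by rewrite lee_fin rgauss_ge0.
have E := @ge0_integralZr _ _ _ (@vol R n) setT measurableT _ mF _ F0 L0.
exact/esym/E.
Qed.

(** The homothety y = a/2 + b produces the factor 2^-n, and the pointwise bound of [edist_midpoint]
    separates a from w. *)
Lemma wills_section K L w : convex_body K -> convex_body L -> K `&` L !=set0 ->
  (2^-1 ^+ n * wills (K `&` L) *
    rgauss (edist (dilate 2^-1 (minkowski_sub K L)) w))%:E <=
  \int[@vol R n]_y (rgauss (edist K (w + y)%R) * rgauss (edist L y))%:E.
Proof.
move=> bK bL KL0; have [_ cK xK] := bK; have [_ cL xL] := bL.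
have bI : convex_body (K `&` L).
  by split => //; [exact: compact_setI_rV|exact: convex_setI_rV].
set M := dilate _ _.
have [b Hb] := edist_midpoint w bK bL KL0.
have mH : measurable_fun setT (fun y : 'rV[R]_n =>
    (rgauss (edist K (w + y)%R) * rgauss (edist L y))%:E).
  apply/measurable_EFinP; apply: measurable_funM.
    apply/measurable_EFinP; apply: (measurableT_comp (measurable_rgauss_edist bK)).
    exact: measurable_rV_add.
  by apply/measurable_EFinP; exact: measurable_rgauss_edist.
have H0 y : 0 <= (rgauss (edist K (w + y)%R) * rgauss (edist L y))%:E.
  by rewrite lee_fin mulr_ge0 ?rgauss_ge0.
rewrite (@ge0_integral_vol_affine R n 2^-1 b _ _ mH H0) ?invr_gt0//.
rewrite -mulrA EFinM; apply: lee_wpmul2l; first by rewrite lee_fin exprn_ge0.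
rewrite mulrC -(wills_integralZ bI (rgauss_ge0 _)).
apply: ge0_le_integral; first exact: measurableT.
- by move=> x _; rewrite lee_fin mulr_ge0 ?rgauss_ge0.
- apply/measurable_EFinP; apply: measurable_funM => //.
  by apply/measurable_EFinP; exact: measurable_rgauss_edist.
- exact: (measurableT_comp mH (measurable_rV_affine _ _)).
move=> a _; rewrite lee_fin /rgauss -2!expRD ler_expR -!opprD lerN2 -!mulrDr.
by rewrite ler_wpM2l ?pi_ge0// [leRHS]addrC; exact: Hb.
Qed.

Local Close Scope ereal_scope.

Lemma wills_capM_le K L : convex_body K -> convex_body L ->
  wills (K `&` L) * wills (dilate 2^-1 (minkowski_sub K L)) <=
  2 ^+ n * (wills K * wills L).
Proof.
(* For disjoint bodies the left side is 0 by the convention for the empty set; otherwise nearest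
   points in the intersection are available. *)
move=> bK bL; have [KL0|KL0] := pselect (K `&` L = set0).
  by rewrite KL0 wills_set0 mul0r !mulr_ge0 ?exprn_ge0 ?wills_ge0.
move/eqP/set0P : KL0 => KL0.
have bM := convex_body_dilate 2^-1 (convex_body_minkowski_sub bK bL).
have bI : convex_body (K `&` L).
  have [_ cK xK] := bK; have [_ cL xL] := bL.
  by split => //; [exact: compact_setI_rV|exact: convex_setI_rV].
suff : 2^-1 ^+ n * wills (K `&` L) * wills (dilate 2^-1 (minkowski_sub K L)) <=
    wills K * wills L.
  by rewrite exprVn -mulrA ler_pdivrMl// exprn_gt0.
have c0 : 0 <= 2^-1 ^+ n * wills (K `&` L).
  by rewrite mulr_ge0 ?exprn_ge0 ?wills_ge0.
rewrite -lee_fin wills_mulE// -(wills_integralZ bM c0).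
apply: ge0_le_integral; first exact: measurableT.
- move=> x _; rewrite lee_fin mulr_ge0 ?rgauss_ge0// mulr_ge0 ?exprn_ge0 ?wills_ge0//.
- apply/measurable_EFinP; apply: measurable_funM => //.
  by apply/measurable_EFinP; exact: measurable_rgauss_edist.
- apply: (@measurable_fun_fubini_tonelli_F _ _ _ _ _ (@vol R n)
    (fun p : 'rV[R]_n * 'rV[R]_n => (rgauss (edist K (p.1 + p.2)) * rgauss (edist L p.2))%:E)).
  + apply/measurable_EFinP; apply: measurable_funM.
      apply/measurable_EFinP; apply: (measurableT_comp (measurable_rgauss_edist bK)).
      by apply: measurable_rV_add.
    by apply/measurable_EFinP; apply: (measurableT_comp (measurable_rgauss_edist bL)).
  + by move=> p; rewrite lee_fin mulr_ge0 ?rgauss_ge0.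
- by move=> w _; exact: wills_section.
Qed.

(** For k in K the distance to K is at most |x - k|, so the integral is at least that of a Gaussian
    centred at k, namely 1. Positivity allows the cancellation in the second inequality of the
    theorem. *)
Lemma wills_gt0 K : convex_body K -> 0 < wills K.
Proof.
move=> bK; have [[k Kk] cK xK] := bK; rewrite -lte_fin -(wills_integral bK).
apply: (@lt_le_trans _ _ (\int[@vol R n]_x (rgauss (enorm x))%:E)%E).
  by rewrite integral_rgauss_enorm lte_fin ltr01.
have K0 x : (0 <= (rgauss (edist K x))%:E)%E by rewrite lee_fin rgauss_ge0.
rewrite (ge0_integral_vol_translate k (measurable_rgauss_edist bK) K0).
apply: ge0_le_integral; first exact: measurableT.
- by move=> x _; rewrite lee_fin rgauss_ge0.
- apply/measurable_EFinP; apply: (measurableT_comp (@measurable_rgauss R)).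
  exact: measurable_enorm.
- apply: (measurableT_comp (measurable_rgauss_edist bK)).
  exact: measurable_rV_add.
move=> x _; rewrite lee_fin ler_expR lerN2 ler_wpM2l ?pi_ge0//.
apply: lerXn2r; rewrite ?nnegrE ?edist_ge0 ?enorm_ge0//.
by rewrite (le_trans (edist_le _ Kk))// addrK.
Qed.

End wills_product.

Theorem theorem1p8 (R : realType) (n : nat) :
  (forall K L : set 'rV[R]_n, convex_body K -> convex_body L ->
     wills (K `&` L) * wills (dilate 2^-1 (minkowski_sub K L)) <=
     2 ^+ n * (wills K * wills L)) /\
  (forall K : set 'rV[R]_n, convex_body K ->
     wills (minkowski_sub K K) <= 2 ^+ n * wills (dilate 2 K)).
Proof.
split=> [K L|K bK]; first exact: wills_capM_le.
have b2K := convex_body_dilate 2 bK.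
(* With both bodies equal to 2K, the intersection is 2K and half the difference body is K - K; one
   factor W(2K) then cancels. *)
have := wills_capM_le b2K b2K; rewrite setIid.
have -> : dilate 2^-1 (minkowski_sub (dilate 2 K) (dilate 2 K)) = minkowski_sub K K.
  apply/seteqP; split => x.
    move=> [_ [_ [y Ky <-] [_ [z Kz <-] <-]] <-].
    exists y => //; exists z => //.
    by rewrite -scalerBr scalerA mulVf// scale1r.
  move=> [y Ky [z Kz <-]]; exists (2 *: y - 2 *: z).
    by exists (2 *: y); [exists y|exists (2 *: z) => //; exists z].
  by rewrite -scalerBr scalerA mulVf// scale1r.
by rewrite mulrCA ler_pM2l// wills_gt0.
Qed.
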